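(* Let $M$ be a closed oriented manifold of dimension $n$ larger than $2$ and let $\Lambda\in\mathfrak{X}^n(M)$ be a generic Nambu structure of top degree. Then the Nambu cohomology group $H^1_\Lambda(M)$, which determines the (infinitesimal) outer automorphisms of the structure, is infinite dimensional.
   Context: Everything is smooth. A Nambu structure of top degree on an $n$-manifold $M$ is an $n$-vector field $\Lambda\in\mathfrak{X}^n(M)=\Gamma(\wedge^nTM)$. It is generic if it is transverse to the zero section of the line bundle $\wedge^nTM$. Nambu bracket: $\{f_1,\dots,f_n\}=\Lambda(df_1\wedge\cdots\wedge df_n)$. The Hamiltonian vector field of $f_1,\dots,f_{n-1}\in C^\infty(M)$ is defined by $X_{f_1,\dots,f_{n-1}}(g)=\{g,f_1,\dots,f_{n-1}\}$. The Nambu cohomology groups are those of the complex of real vector spaces $$0\to\wedge^{n-1}C^\infty(M)\to\mathfrak{X}(M)\to\mathfrak{X}^n(M)\to0,$$ with maps $f_1\wedge\cdots\wedge f_{n-1}\mapsto X_{f_1,\dots,f_{n-1}}$ and $X\mapsto\mathcal{L}_X\Lambda$. Thus $H^1_\Lambda(M)$ is the quotient of $\{X\in\mathfrak{X}(M):\mathcal{L}_X\Lambda=0\}$ by the linear span of the Hamiltonian vector fields.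
   Formalization: The formal theorem adds that Λ vanishes somewhere on M; for nowhere-zero Λ (vacuously generic) H^1 is H^{n-1}_dR(M), which is finite dimensional. The descriptive clause on outer automorphisms is not formalized. *)

(* Defs.v *)
From HB Require Import structures.
From mathcomp Require Import all_boot all_order all_algebra.
From mathcomp Require Import all_classical all_reals all_analysis.

Set Implicit Arguments.
Unset Strict Implicit.
Unset Printing Implicit Defensive.

Import Order.TTheory GRing.Theory Num.Theory.
Import numFieldNormedType.Exports.

Local Open Scope classical_set_scope.
Local Open Scope ring_scope.

Section Smoothness.
Variables (R : realType) (n : nat).
Implicit Types (f : 'rV[R]_n -> R) (U : set 'rV[R]_n).

Definition partial (a : 'I_n) f : 'rV[R]_n -> R :=
  fun x => 'D_(delta_mx 0 a) f x.

Definition partials (s : seq 'I_n) f : 'rV[R]_n -> R := foldr partial f s.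

(* C^oo on an open set U: every iterated partial derivative, including f
   itself ([s] empty), is Frechet differentiable at every point of U. *)
Definition smooth_on U f :=
  forall (s : seq 'I_n) x, U x -> differentiable (partials s f) x.

Definition smooth_map_on m U (F : 'rV[R]_n -> 'rV[R]_m) :=
  forall b : 'I_m, smooth_on U (fun x => F x 0 b).

End Smoothness.

Section Charts.
Variables (R : realType) (n : nat) (T : topologicalType).

(* A homeomorphism from the open set [dom] of T onto the open set [cod] of R^n,
   with inverse [param]; the values of [coord] outside [dom] and of [param]
   outside [cod] are irrelevant. *)
Record chart := Chart {
  dom : set T;
  cod : set 'rV[R]_n;
  coord : T -> 'rV[R]_n;
  param : 'rV[R]_n -> T;
  open_dom : open dom;
  open_cod : open cod;
  coord_cod : forall p, dom p -> cod (coord p);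
  param_dom : forall x, cod x -> dom (param x);
  coordK : forall p, dom p -> param (coord p) = p;
  paramK : forall x, cod x -> coord (param x) = x;
  coord_continuous : forall p, dom p -> {for p, continuous coord};
  param_continuous : forall x, cod x -> {for x, continuous param}
}.

Definition overlap (c d : chart) : set 'rV[R]_n :=
  cod c `&` param c @^-1` dom d.

Definition transition (c d : chart) : 'rV[R]_n -> 'rV[R]_n :=
  coord d \o param c.

End Charts.

(* The manifolds have no boundary, since charts take values in open subsets of
   R^n.  Hence a closed manifold is one with [compact [set: M]]. *)
Record smooth_manifold (R : realType) (n : nat) := SmoothManifold {
  carrier :> topologicalType;
  manifold_hausdorff : hausdorff_space carrier;
  manifold_second_countable : @second_countable carrier;
  atlas_index : Type;
  atlas : atlas_index -> chart R n carrier;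
  atlas_cover : forall p : carrier, exists i, dom (atlas i) p;
  atlas_smooth : forall i j,
    smooth_map_on (overlap (atlas i) (atlas j))
                  (transition (atlas i) (atlas j))
}.

Section Nambu.
Variables (R : realType) (n : nat) (M : smooth_manifold R n).

Local Notation I := (atlas_index M).

(* ['J F x] acts on row vectors from the right: its entry (a, b) is the
   derivative of the b-th component of F along the a-th coordinate. *)
Definition oriented_manifold :=
  forall (i j : I) x, overlap (atlas i) (atlas j) x ->
    0 < \det ('J (transition (atlas i) (atlas j)) x).

Definition smooth_fun (f : M -> R) :=
  forall i : I, smooth_on (cod (atlas i)) (f \o param (atlas i)).

(* Tensor fields are families of local expressions, one for each chart, on
   which the change of coordinates imposes the usual transformation rule.
   Requiring the value 0 outside [cod] makes equality of families coincide
   with equality of fields, and makes the fields linear subspaces of the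
   function spaces below. *)
Definition vfield_data : Type := I -> 'rV[R]_n -> 'rV[R]_n.

(* X = \sum_a (X i x) 0 a d/dx_a in the i-th chart. *)
Definition vector_field (X : vfield_data) :=
  [/\ forall i, smooth_map_on (cod (atlas i)) (X i),
      forall i j x, overlap (atlas i) (atlas j) x ->
        X j (transition (atlas i) (atlas j) x)
        = X i x *m 'J (transition (atlas i) (atlas j)) x &
      forall i x, ~ cod (atlas i) x -> X i x = 0].

Definition nvector_data : Type := I -> 'rV[R]_n -> R.

(* L = (L i x) d/dx_1 /\ ... /\ d/dx_n in the i-th chart: a section of the line
   bundle \wedge^n TM, whose transition functions are the Jacobian
   determinants. *)
Definition nvector_field (L : nvector_data) :=
  [/\ forall i, smooth_on (cod (atlas i)) (L i),
      forall i j x, overlap (atlas i) (atlas j) x ->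
        L j (transition (atlas i) (atlas j) x)
        = \det ('J (transition (atlas i) (atlas j)) x) * L i x &
      forall i x, ~ cod (atlas i) x -> L i x = 0].

Definition zero_locus (L : nvector_data) : set M :=
  [set p | exists2 i : I, dom (atlas i) p & L i (coord (atlas i) p) = 0].

(* Transversality to the zero section.  In the trivialization over the i-th
   chart the section is x |-> (x, L i x); where it meets the zero section
   R^n x {0}, the image of its differential together with the tangent space
   of the zero section must span R^n x R. *)
Definition generic (L : nvector_data) :=
  forall (i : I) x, cod (atlas i) x -> L i x = 0 ->
    forall (w : 'rV[R]_n) (t : R), exists u v : 'rV[R]_n,
      (w, t) = (u + v, 0 + 'd (L i) x v).

(* Local expression of {f_1, ..., f_n} = L(df_1 /\ ... /\ df_n). *)
Definition nambu_bracket (L : nvector_data) (f : 'I_n -> M -> R) (i : I)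
    (x : 'rV[R]_n) : R :=
  L i x * \det (\matrix_(k < n, a < n) partial a (f k \o param (atlas i)) x).

(* Local expression of the function X(g). *)
Definition vfield_apply (X : vfield_data) (g : M -> R) (i : I)
    (x : 'rV[R]_n) : R :=
  'd (g \o param (atlas i)) x (X i x).

(* The n-tuple (g, f 0, ..., f (n - 2)). *)
Definition bracket_args (g : M -> R) (f : nat -> M -> R) (k : 'I_n) : M -> R :=
  if val k is k'.+1 then f k' else g.

(* X is the Hamiltonian vector field of f 0, ..., f (n - 2); the other terms
   of the sequence f play no role. *)
Definition hamiltonian_vfield_of (L : nvector_data) (f : nat -> M -> R)
    (X : vfield_data) :=
  vector_field X /\
  forall g, smooth_fun g -> forall i x, cod (atlas i) x ->
    vfield_apply X g i x = nambu_bracket L (bracket_args g f) i x.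

Definition hamiltonian_vfields (L : nvector_data) : set vfield_data :=
  [set X | exists2 f : nat -> M -> R,
     (forall k, smooth_fun (f k)) & hamiltonian_vfield_of L f X].

(* Local expression of the Lie derivative, from the Leibniz rule
     L_X (h d/dx_1 /\ ... /\ d/dx_n) = X(h) d/dx_1 /\ ... /\ d/dx_n
       + h \sum_a d/dx_1 /\ ... /\ [X, d/dx_a] /\ ... /\ d/dx_n
   and [X, d/dx_a] = - \sum_b (dX^b/dx_a) d/dx_b, of which only the term b = a
   survives in the wedge product. *)
Definition lie_derivative (X : vfield_data) (L : nvector_data) (i : I)
    (x : 'rV[R]_n) : R :=
  'd (L i) x (X i x)
  - L i x * \sum_(a < n) partial a (fun y => X i y 0 a) x.

Definition nambu_cocycles (L : nvector_data) : set vfield_data :=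
  [set X | vector_field X /\
     forall i x, cod (atlas i) x -> lie_derivative X L i x = 0].

End Nambu.

Section LinearAlgebra.
Variables (R : realType) (V : lmodType R).
Implicit Types A B Z : set V.

Definition linear_span A : set V :=
  [set v | exists m (c : 'I_m -> R) (h : 'I_m -> V),
     (forall k, A (h k)) /\ v = \sum_(k < m) c k *: h k].

(* The classes of finitely many elements of Z span the quotient Z / B, where Z
   and B are linear subspaces of V. *)
Definition finite_dim_quotient Z B :=
  exists m (b : 'I_m -> V), (forall k, Z (b k)) /\
    forall z, Z z -> exists c : 'I_m -> R, B (z - \sum_(k < m) c k *: b k).

Definition infinite_dim_quotient Z B := ~ finite_dim_quotient Z B.

End LinearAlgebra.

Section Cohomology.
Variables (R : realType) (n : nat) (M : smooth_manifold R n).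

Definition nambu_coboundaries (L : nvector_data M) : set (vfield_data M) :=
  linear_span (hamiltonian_vfields L).

Definition nambu_H1_infinite_dimensional (L : nvector_data M) :=
  infinite_dim_quotient (nambu_cocycles L) (nambu_coboundaries L).

End Cohomology.

(* Main.v *)
Require Import Defs.
From mathcomp Require Import all_boot all_order all_algebra fingroup perm.
From mathcomp Require Import all_classical all_reals all_analysis.
From mathcomp Require Import ring lra.

Set Implicit Arguments.
Unset Strict Implicit.
Unset Printing Implicit Defensive.

Import Order.TTheory GRing.Theory Num.Theory.
Import numFieldNormedType.Exports.

Local Open Scope classical_set_scope.
Local Open Scope ring_scope.

(** Let p be a zero of L lying in a chart with coordinates x_1, ..., x_n, write
    L = h d/dx_1 /\ ... /\ d/dx_n there, and choose a, b, c distinct with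
    dh/dx_a <> 0 at p (genericity; this is where n > 2 is used).  For a function
    f supported in the chart, the field X_f with
      i_{X_f} (dx_1 /\ ... /\ dx_n) = dh /\ df /\ (the dx_d with d <> a, b, c)
    is divergence free and kills h, so extended by 0 it is a cocycle; off the zero
    locus it is, up to sign, the Hamiltonian field of log |h|, f and these x_d.
    Hamiltonian fields carry a factor L, hence coboundaries vanish on the zero
    locus Z.  The X_f do not: if f = x_c^(k+1) near p, the b-th component of X_f
    is - dh/dx_a (k+1) x_c^k.  As x_c takes infinitely many values on Z near p,
    no nontrivial combination of these components vanishes on Z, so the classes
    of the X_f are linearly independent.

    The cocycle condition is computed in one chart.  It holds in all others
    because L_X L transforms by the Jacobian determinant, which follows from
    Jacobi's formula and the symmetry of second derivatives. *)

(** The first-order expansion of [f] at [x] is also one of [g], since only small increments matter,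
    and the differential is unique. Local expressions in charts mostly agree only near a point, so
    derivatives are transferred through this lemma. *)
Lemma near_eq_diff (K : numFieldType) (V W : normedModType K) (f g : V -> W)
    (x : V) : {near x, f =1 g} -> differentiable f x ->
  differentiable g x /\ 'd g x = 'd f x :> (V -> W).
Proof.
move=> fg df; have fgx := nbhs_singleton fg.
have gE : g \o shift x = cst (g x) + 'd f x +o_ 0 id.
  have /eqaddoP fE := diff_locally df.
  apply/eqaddoP => e e0.
  have fgh : \forall h \near (0 : V), f (h + x) = g (h + x).
    by move: fg; rewrite (near_shift 0) subr0.
  apply: filterS2 fgh (fE e e0) => h fgh.
  rewrite -![(_ + _ : _ -> _) _]/(_ + _) -![(- _ : _ -> _) _]/(- _) /= -fgx.
  by rewrite -fgh.
have dgE : 'd g x = 'd f x :> (V -> W) by apply: diff_unique => //;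
  exact: diff_continuous.
split => //; apply/diff_locallyP; split; first by rewrite dgE;
  exact: diff_continuous.
by rewrite dgE.
Qed.

(** * Smooth functions on open subsets of R^n *)

Section SmoothFunctions.
Variables (R : realType) (n : nat).
Local Notation V := ('rV[R]_n).
Implicit Types (f g : V -> R) (U : set V) (a : 'I_n).

(** Smoothness graded by order, so that closure properties go by induction on [N]: the partial
    derivatives of a product or a composite are sums of products of functions smooth up to the
    previous order. *)
Fixpoint smooth_upto N U f : Prop :=
  (forall x, U x -> differentiable f x) /\
  if N is N'.+1 then forall a, smooth_upto N' U (partial a f) else True.

Lemma smooth_onP U f : smooth_on U f <-> forall N, smooth_upto N U f.
Proof.
split=> [sf N|sf s].
  elim: N f sf => [|N IH] f sf /=; split => //; try exact: (sf [::]).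
  (* The last entry of the sequence is the innermost derivative, the one applied to [f] first. *)
  move=> a; apply: IH => s x Ux; have := sf (rcons s a) x Ux.
  by rewrite /partials foldr_rcons.
elim/last_ind: s f sf => [|s a IH] f sf x Ux; first exact: (sf 0%N).1.
rewrite /partials foldr_rcons; apply: IH Ux => N; exact: (sf N.+1).2.
Qed.

Lemma smooth_uptoW N U f : smooth_upto N.+1 U f -> smooth_upto N U f.
Proof.
elim: N f => [|N IH] f [H1 H2]; split => // a; apply: IH; exact: H2.
Qed.

Lemma open_near_eq (T : topologicalType) (Y : Type) (U : set T) (f g : T -> Y) x :
  open U -> U x -> {in U, f =1 g} -> {near x, f =1 g}.
Proof.
move=> oU Ux fg; apply: filterS (open_nbhs_nbhs (conj oU Ux)) => y Uy.
by apply: fg; rewrite inE.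
Qed.

Lemma near_eq_partial f g a x : {near x, f =1 g} -> partial a f x = partial a g x.
Proof. by move=> fg; rewrite /partial; apply: near_eq_derive. Qed.

Lemma eq_smooth_upto N U f g : open U -> {in U, f =1 g} ->
  smooth_upto N U f -> smooth_upto N U g.
Proof.
move=> oU; elim: N f g => [|N IH] f g fg [H1 H2]; split => //.
- move=> x Ux; have := near_eq_diff (open_near_eq oU Ux fg) (H1 x Ux);
    exact: proj1.
- move=> x Ux; have := near_eq_diff (open_near_eq oU Ux fg) (H1 x Ux);
    exact: proj1.
move=> a; apply: IH (H2 a) => x; rewrite inE => Ux.
exact: near_eq_partial (open_near_eq oU Ux fg).
Qed.

Lemma partialE f a x : differentiable f x -> partial a f x = 'd f x (delta_mx 0
  a).
Proof. by move=> df; rewrite /partial deriveE. Qed.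

Lemma partialD f g a x : differentiable f x -> differentiable g x ->
  partial a (f + g) x = partial a f x + partial a g x.
Proof. by move=> df dg; rewrite /partial deriveD //; apply: diff_derivable. Qed.

Lemma partialM f g a x : differentiable f x -> differentiable g x ->
  partial a (f * g) x = f x * partial a g x + g x * partial a f x.
Proof. by move=> df dg; rewrite /partial deriveM //; apply: diff_derivable. Qed.

Lemma smooth_upto_cst N U (k : R) : smooth_upto N U (cst k).
Proof.
elim: N k => [|N IH] k; split=> //; try by move=> x _; exact: differentiable_cst.
move=> a; rewrite (_ : partial a (cst k) = cst 0); first exact: IH.
by apply/funext => x; rewrite /partial derive_cst.
Qed.

Lemma smooth_uptoD N U f g : open U -> smooth_upto N U f -> smooth_upto N U g ->
  smooth_upto N U (f + g).
Proof.
move=> oU; elim: N f g => [|N IH] f g [f1 f2] [g1 g2]; split => //; try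
  by move=> x Ux; apply: differentiableD; [exact: f1|exact: g1].
move=> a; apply: eq_smooth_upto (IH _ _ (f2 a) (g2 a)) => // x; rewrite inE => Ux.
by rewrite partialD //; [exact: f1|exact: g1].
Qed.

Lemma smooth_uptoM N U f g : open U -> smooth_upto N U f -> smooth_upto N U g ->
  smooth_upto N U (f * g).
Proof.
move=> oU; elim: N f g => [|N IH] f g sf sg; have [f1 f2] := sf;
  have [g1 g2] := sg; split => //; try
  by move=> x Ux; apply: differentiableM; [exact: f1|exact: g1].
move=> a.
apply: (@eq_smooth_upto _ _ (f * partial a g + g * partial a f)) => //.
  by move=> x; rewrite inE => Ux; rewrite partialM //; [exact: f1|exact: g1].
by apply: smooth_uptoD => //; apply: IH => //;
  [exact: smooth_uptoW sf|exact: g2|exact: smooth_uptoW sg|exact: f2].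
Qed.

Lemma smooth_on_diff U f x : smooth_on U f -> U x -> differentiable f x.
Proof. by move=> sf; exact: (sf [::]). Qed.

Lemma smooth_on_partial U f a : smooth_on U f -> smooth_on U (partial a f).
Proof. by move=> /smooth_onP sf; apply/smooth_onP => N; exact: (sf N.+1).2. Qed.

Lemma eq_smooth_on U f g : open U -> {in U,
  f =1 g} -> smooth_on U f -> smooth_on U g.
Proof. by move=> oU fg /smooth_onP sf; apply/smooth_onP => N;
  exact: eq_smooth_upto (sf N). Qed.

Lemma smooth_on_sub U U' f : U' `<=` U -> smooth_on U f -> smooth_on U' f.
Proof. by move=> sub sf s x /sub; exact: sf. Qed.

Lemma smooth_on_local U f :
  (forall x, U x -> exists2 W : set V, W x & smooth_on W f) -> smooth_on U f.
Proof. by move=> H s x /H[W Wx]; exact. Qed.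

Lemma smooth_on_cst U (k : R) : smooth_on U (cst k).
Proof. by apply/smooth_onP => N; exact: smooth_upto_cst. Qed.

Lemma smooth_onD U f g : open U -> smooth_on U f -> smooth_on U g -> smooth_on
  U (f + g).
Proof. by move=> oU /smooth_onP sf /smooth_onP sg; apply/smooth_onP => N;
  exact: smooth_uptoD. Qed.

Lemma smooth_onM U f g : open U -> smooth_on U f -> smooth_on U g -> smooth_on
  U (f * g).
Proof. by move=> oU /smooth_onP sf /smooth_onP sg; apply/smooth_onP => N;
  exact: smooth_uptoM. Qed.

Lemma smooth_onN U f : open U -> smooth_on U f -> smooth_on U (- f).
Proof.
move=> oU sf; rewrite (_ : - f = cst (-1) * f); last first.
  by apply/funext => x /=; rewrite /GRing.mul /= mulN1r.
by apply: smooth_onM => //; exact: smooth_on_cst.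
Qed.

Lemma smooth_onB U f g : open U -> smooth_on U f -> smooth_on U g -> smooth_on
  U (f - g).
Proof. by move=> oU sf sg; apply: smooth_onD => //; exact: smooth_onN. Qed.

Lemma smooth_on_sum (I : Type) (r : seq I) (P : pred I) (F : I -> V -> R) U :
  open U -> (forall i, P i -> smooth_on U (F i)) -> smooth_on U (\sum_(i <- r |
    P i) F i).
Proof.
move=> oU sF; elim/big_ind: _ => //; first exact: smooth_on_cst.
by move=> f g; exact: smooth_onD.
Qed.

Lemma partial_coord a b x : partial a (fun x : V => x 0 b) x = (a == b)%:R.
Proof.
rewrite partialE; last exact: differentiable_coord.
have @f : {linear V -> R}.
  by exists (fun N : V => N 0 b); do 2![eexists]; do ?[constructor];
     rewrite ?mxE// => ? *; rewrite ?mxE//; move=> ?; rewrite !mxE.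
rewrite (_ : (fun _ => _) = f) // diff_lin; last exact: coord_continuous.
by rewrite /f /= mxE eqxx eq_sym.
Qed.

Lemma smooth_on_coord U b : smooth_on U (fun x : V => x 0 b).
Proof.
apply/smooth_onP => -[|N]; split=> //; try by move=> x _;
  exact: differentiable_coord.
move=> a; rewrite (_ : partial a _ = cst ((a == b)%:R));
  first exact: smooth_upto_cst.
by apply/funext => x; rewrite partial_coord.
Qed.

Lemma diff_partial f x v : differentiable f x -> 'd f x v = \sum_a v 0 a *
  partial a f x.
Proof.
move=> df; rewrite {1}(row_sum_delta v) raddf_sum; apply: eq_bigr => a _.
by rewrite [LHS]linearZ partialE.
Qed.

End SmoothFunctions.

(** * Maps between coordinate spaces and the chain rule *)

Section Maps.
Variables (R : realType) (n m : nat).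
Local Notation V := ('rV[R]_n).
Local Notation W := ('rV[R]_m).
Implicit Types (F : V -> W) (f : W -> R).

Lemma differentiable_components F x :
  (forall b, differentiable (fun y => F y 0 b) x) -> differentiable F x.
Proof.
move=> dF.
rewrite (_ : F = \sum_b (fun y => F y 0 b *: (delta_mx 0 b : W))); last first.
  by apply/funext => y; rewrite fct_sumE {1}(row_sum_delta (F y)).
apply: differentiable_sum => b; exact: differentiableZl.
Qed.

Lemma diff_component F x v b : differentiable F x ->
  ('d F x v) 0 b = 'd (fun y => F y 0 b) x v.
Proof.
move=> dF.
have @c : {linear W -> R}.
  by exists (fun N : W => N 0 b); do 2![eexists]; do ?[constructor];
     rewrite ?mxE// => ? *; rewrite ?mxE//; move=> ?; rewrite !mxE.
have cc : continuous c by exact: coord_continuous.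
have dc : differentiable c (F x) by exact: linear_differentiable.
rewrite (_ : (fun y => F y 0 b) = c \o F) // (diff_comp dF dc).
by rewrite -[RHS]/('d c (F x) ('d F x v)) (diff_lin _ cc).
Qed.

Lemma jacobianE F x a b : differentiable F x ->
  'J F x a b = partial a (fun y => F y 0 b) x.
Proof.
move=> dF; rewrite /jacobian mxE diff_component // partialE //.
rewrite (_ : (fun y => F y 0 b) = (fun N : W => N 0 b) \o F) //.
apply: differentiable_comp => //; exact: differentiable_coord.
Qed.

Lemma diff_jacobian F x v : 'd F x v = v *m 'J F x.
Proof. by rewrite /jacobian mul_rV_lin1. Qed.

Lemma partial_comp F f x a : differentiable F x -> differentiable f (F x) ->
  partial a (f \o F) x = \sum_b 'J F x a b * partial b f (F x).
Proof.
move=> dF df; rewrite partialE; last exact: differentiable_comp.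
rewrite diff_comp //= diff_partial //; apply: eq_bigr => b _.
by rewrite diff_jacobian -rowE mxE.
Qed.

Lemma smooth_map_diff U F x : smooth_map_on U F -> U x -> differentiable F x.
Proof. by move=> sF Ux; apply: differentiable_components => b;
  exact: smooth_on_diff (sF b) Ux. Qed.

(** By the chain rule a partial derivative of the composite is a sum of smooth functions times
    composites of [F] with partial derivatives of [f], so induction on the order of smoothness of
    [f] applies. *)
Lemma smooth_on_comp (U : set V) (U' : set W) F f : open U ->
  (forall x, U x -> U' (F x)) -> smooth_map_on U F -> smooth_on U' f ->
  smooth_on U (f \o F).
Proof.
move=> oU FU sF /smooth_onP sf; apply/smooth_onP => N.
elim: N f {sf}(sf N) => [|N IH] f [f1 f2]; split => //;
  try by move=> x Ux; apply: differentiable_comp;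
    [exact: smooth_map_diff sF Ux|apply: f1; exact: FU].
move=> a; apply: (@eq_smooth_upto _ _ _ _
  (\sum_b partial a (fun y => F y 0 b) * (partial b f \o F))) => //.
  move=> x; rewrite inE => Ux.
  rewrite partial_comp //; [|exact: smooth_map_diff sF Ux|apply: f1; exact: FU].
  rewrite fct_sumE; apply: eq_bigr => b _.
  rewrite jacobianE //; exact: smooth_map_diff sF Ux.
elim/big_ind: _ => //; first exact: smooth_upto_cst.
  by move=> ? ?; exact: smooth_uptoD.
move=> b _; apply: smooth_uptoM => //; last by apply: IH; exact: f2.
by have /smooth_onP := smooth_on_partial a (sF b).
Qed.

End Maps.

(** * Symmetry of second derivatives *)

Section Schwarz.
Variables (R : realType).

Lemma is_derive_line (V W : normedModType R) (f : V -> W) (y u : V) (s : R) :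
  differentiable f (y + s *: u) ->
  is_derive s 1 (fun s => f (y + s *: u)) ('D_u f (y + s *: u)).
Proof.
move=> df; have dl : is_diff s (fun s : R => y + s *: u) (fun s => s *: u).
  have := @is_diffD R _ V (cst y : R -> V) ( *:%R ^~ u : R -> V) 0 ( *:%R ^~ u)
    s _ _.
  by rewrite add0r; apply; typeclasses eauto.
have dc : differentiable (f \o (fun s : R =>
  y + s *: u)) s by apply: differentiable_comp.
split; first exact: diff_derivable.
by rewrite deriveE // diff_comp //= deriveE // diff_val /= scale1r.
Qed.

Lemma MVT_line (V : normedModType R) (f : V -> R) (y u : V) (t : R) : 0 < t ->
  (forall s, 0 <= s <= t -> differentiable f (y + s *: u)) ->
  exists2 c, 0 <= c <= t & f (y + t *: u) - f y = t * 'D_u f (y + c *: u).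
Proof.
move=> t0 df.
have [|s| |c] := @MVT_segment R (fun s => f (y + s *: u)) (fun s =>
  'D_u f (y + s *: u)) 0 t.
- exact: ltW.
- rewrite in_itv /= => /andP[s0 st]; apply: is_derive_line; apply: df.
  by rewrite !ltW.
- apply: derivable_within_continuous => s; rewrite in_itv /= => st.
  by have [] := is_derive_line (df s st).
by rewrite in_itv /= scale0r addr0 subr0 mulrC => ct ->; exists c.
Qed.

(** The mean value theorem is used twice: along [u] for the increment [f (y + t *: v) - f y], then
    along [v] for ['D_u f]. Each use contributes a factor [t], and the bound on [t] keeps the whole
    parallelogram in the ball of radius [d]. *)
Lemma second_difference (V : normedModType R) (f : V -> R) (x u v : V) (d t : R) :
  0 < t -> t * (`|u| + `|v|) < d ->
  (forall y, `|y - x| < d -> differentiable f y) ->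
  (forall y, `|y - x| < d -> differentiable ('D_u f) y) ->
  exists2 p, `|p - x| < d &
    f (x + t *: u + t *: v) - f (x + t *: u) - f (x + t *: v) + f x
    = t * (t * 'D_v ('D_u f) p).
Proof.
move=> t0 td df ddf.
have B (s r : R) : 0 <= s <= t -> 0 <= r <= t -> `|x + s *: u + r *: v - x| < d.
  move=> /andP[s0 st] /andP[r0 rt]; rewrite -(addrA x) [X in `|X|]addrC addKr.
  apply: le_lt_trans td; apply: (le_trans (ler_normD _ _)).
  by rewrite !normrZ mulrDr !ger0_norm // lerD // ler_wpM2r.
have t1 : 0 <= t <= t by rewrite lexx ltW.
have t2 : (0 : R) <= 0 <= t by rewrite lexx ltW.
have B0 s : 0 <= s <= t -> `|x + s *: u - x| < d.
  by move=> st; have := B s 0 st t2; rewrite scale0r addr0.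
pose g y := f (y + t *: v) - f y.
have dg s : 0 <= s <= t -> is_derive (x + s *: u) u g ('D_u f (x + s *: u + t
  *: v) - 'D_u f (x + s *: u)).
  move=> st; apply: is_deriveB; last by apply: DeriveDef => //;
    apply: diff_derivable; apply: df; exact: B0.
  have dh : is_diff (x + s *: u) (fun y => y + t *: v) id.
    have := @is_diffD R V V id (cst (t *: v)) id 0 (x + s *: u) _ _.
    by rewrite addr0; apply; typeclasses eauto.
  have dc : differentiable (f \o (fun y => y + t *: v)) (x + s *: u).
    by apply: differentiable_comp => //; apply: df; exact: B.
  split; first exact: diff_derivable.
  rewrite deriveE // diff_comp //=; last by apply: df; exact: B.
  by rewrite diff_val /= deriveE //; apply: df; exact: B.
have [|c ct gE] := @MVT_line V g x u t t0.
  move=> s st; apply: differentiableB; last by apply: df; exact: B0.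
  apply: (@differentiable_comp _ _ _ _ (fun y => y + t *: v) f) => //;
    apply: df; exact: B.
have [|c' ct' DE] := @MVT_line V ('D_u f) (x + c *: u) v t t0.
  by move=> r rt; apply: ddf; exact: B. exists (x + c *: u + c' *: v);
    first exact: B.
rewrite -DE; have [_ <-] := dg c ct; rewrite -gE /g; ring.

Qed.

(** The second difference is symmetric in [u] and [v], so the two mixed derivatives take a common
    value at points [p] and [q] arbitrarily close to [x]. If they differed at [x], continuity would
    put this value within half of the gap of both. *)
Lemma derive_symmetric (V : normedModType R) (f : V -> R) (x u v : V) :
  (\forall y \near x, [/\ differentiable f y, differentiable ('D_u f) y &
     differentiable ('D_v f) y]) ->
  {for x, continuous ('D_v ('D_u f))} -> {for x, continuous ('D_u ('D_v f))} ->
  'D_v ('D_u f) x = 'D_u ('D_v f) x.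
Proof.
move=> df c1 c2; apply/eqP/negP => /negP ne.
pose e := `|'D_v ('D_u f) x - 'D_u ('D_v f) x| / 2.
have e0 : 0 < e by rewrite divr_gt0 // normr_gt0 subr_eq0.
have near1 : \forall y \near x, `|'D_v ('D_u f) x - 'D_v ('D_u f) y| < e.
  exact: ((cvgrPdist_lt _ _).1 c1).
have near2 : \forall y \near x, `|'D_u ('D_v f) x - 'D_u ('D_v f) y| < e.
  exact: ((cvgrPdist_lt _ _).1 c2).
have := @filterI _ (nbhs x) (nbhs_filter x) _ _ df (@filterI _ (nbhs x)
  (nbhs_filter x) _ _ near1 near2).
move/nbhs_ballP => [d /= d0 Bd].
have {}Bd y : `|y - x| < d ->
  [/\ [/\ differentiable f y,
    differentiable ('D_u f) y & differentiable ('D_v f) y],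
   `|'D_v ('D_u f) x - 'D_v ('D_u f) y| < e & `|'D_u ('D_v f) x - 'D_u ('D_v f)
     y| < e].
  by move=> yx; have [|? []] := Bd y; [rewrite -ball_normE /= distrC|split].
(* The summand 1 makes [K] positive even when [u] and [v] vanish, and makes the size condition on
   [t] strict. *)
pose K := `|u| + `|v| + 1.
have K0 : 0 < K by rewrite ltr_wpDl // addr_ge0.
pose t := d / K.
have t0 : 0 < t by rewrite divr_gt0.
have tK : t * (`|u| + `|v|) < d by rewrite /t mulrAC ltr_pdivrMr // ltr_pM2l //
  /K ltrDl.
have d1 y : `|y - x| < d -> differentiable f y by move=> /Bd[[]].
have d2 y : `|y - x| < d -> differentiable ('D_u f) y by move=> /Bd[[]].
have d3 y : `|y - x| < d -> differentiable ('D_v f) y by move=> /Bd[[]].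
have [p px E1] := second_difference t0 tK d1 d2.
have tK' : t * (`|v| + `|u|) < d by rewrite [_ + `|u|]addrC.
have [q qx E2] := second_difference t0 tK' d1 d3.
have cancelE (a b c e' P Q : R) :
    a - b - c + e' = t * (t * P) -> a - c - b + e' = t * (t * Q) -> P = Q.
  move=> EP EQ; apply: (mulfI (lt0r_neq0 t0)); apply: (mulfI (lt0r_neq0 t0)).
  by rewrite -EP -EQ; ring.
rewrite (addrAC x (t *: v) (t *: u)) in E2.
have E := cancelE _ _ _ _ _ _ E1 E2.
have [_ A _] := Bd p px; have [_ _ B] := Bd q qx; rewrite E in A.
have farE (a b c : R) : `|a - c| < `|a - b| / 2 -> `|b - c| < `|a - b| / 2 ->
  False.
  rewrite [`|b - c|]distrC => ac cb.
  by have := le_lt_trans (ler_distD c a b) (ltrD ac cb); rewrite -splitr ltxx.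
exact: farE A B.
Qed.

End Schwarz.

Lemma partial_symmetric (R : realType) (n : nat) (U : set 'rV[R]_n) f a b x :
  open U -> smooth_on U f -> U x ->
  partial a (partial b f) x = partial b (partial a f) x.
Proof.
move=> oU sf Ux; apply: derive_symmetric.
- apply: filterS (open_nbhs_nbhs (conj oU Ux)) => y Uy.
  by split; [exact: (sf [::])|exact: (sf [:: b])|exact: (sf [:: a])].
- exact: differentiable_continuous (sf [:: a; b] x Ux).
- exact: differentiable_continuous (sf [:: b; a] x Ux).
Qed.

(** * Bump functions *)

Section Flat.
Variable R : realType.
Implicit Types (t : R) (k : nat).

(* [flat 0] is exp(-1/t) for t > 0; the powers of 1/t make the family closed
   under differentiation. *)
Definition flat k t : R := if 0 < t then t^-1 ^+ k * expR (- t^-1) else 0.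

Lemma flat_le0 k t : t <= 0 -> flat k t = 0.
Proof. by rewrite /flat leNgt => /negbTE ->. Qed.

Lemma flat_gt0 k t : 0 < t -> 0 < flat k t.
Proof. by move=> t0; rewrite /flat t0 mulr_gt0 ?expR_gt0 // exprn_gt0 //
  invr_gt0. Qed.

Lemma flat_ge0 k t : 0 <= flat k t.
Proof. by have [/flat_le0 ->//|/(flat_gt0 k)/ltW] := leP t 0. Qed.

Lemma flat0_le s t : s <= t -> flat 0 s <= flat 0 t.
Proof.
move=> st; have [/flat_le0 ->|s0] := leP s 0; first exact: flat_ge0.
have t0 := lt_le_trans s0 st.
by rewrite /flat s0 t0 !expr0 !mul1r ler_expR lerN2 lef_pV2.
Qed.

(** For positive [k], the k-th power of u <= k exp(u/k), which follows from 1 + u/k <= exp(u/k). *)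
Lemma exp_dominates_power k (u : R) : 0 <= u -> u ^+ k * expR (- u) <= k%:R ^+ k.
Proof.
move=> u0; case: k => [|k];
  first by rewrite !expr0 mul1r -expR0 ler_expR oppr_le0.
have k0 : 0 < k.+1%:R :> R by rewrite ltr0n.
rewrite expRN ler_pdivrMr ?expR_gt0 // -[u in expR u](divfK (lt0r_neq0 k0)).
rewrite expRM_natr -exprMn; apply: lerXn2r;
  rewrite ?nnegrE ?mulr_ge0 ?expR_ge0 ?(ltW k0) //.
apply: (@le_trans _ _ (k.+1%:R * (u / k.+1%:R)));
  first by rewrite mulrC divfK // gt_eqF.
apply: ler_wpM2l; first exact: ltW.
by apply: le_trans (expR_ge1Dx _); rewrite lerDr.
Qed.

(** With u = 1/t the claim bounds u^(k+2) exp(-u). A quadratic bound is what makes the difference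
    quotient at 0 tend to 0. *)
Lemma flat_bound k : exists2 C : R, 0 <= C & forall t, `|flat k t| <= C * t ^+ 2.
Proof.
exists ((k + 2)%:R ^+ (k + 2)); first exact: exprn_ge0.
move=> t; rewrite ger0_norm ?flat_ge0 //; have [/flat_le0 ->|t0] := leP t 0.
  by rewrite mulr_ge0 ?sqr_ge0 // exprn_ge0.
have ti : 0 <= t^-1 by rewrite invr_ge0 ltW.
rewrite -ler_pdivrMr ?exprn_gt0 // /flat t0 -exprVn mulrAC -exprD.
exact: exp_dominates_power.
Qed.

(** Away from 0 one differentiates t^(-k) exp(-1/t) or the constant 0; at 0 the difference quotient
    is at most C |h| by [flat_bound]. *)
Lemma is_derive_flat k t : is_derive t 1 (flat k) (flat k.+2 t - k%:R * flat
  k.+1 t).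
Proof.
have [t0|t0|<-] := ltgtP 0 t.
- have E : \near t, (fun s => s^-1 ^+ k * expR (- s^-1)) t = flat k t.
    by apply: filterS (lt_nbhsr t0) => s s0; rewrite /flat s0.
  apply: near_eq_is_derive E _.
  have dV : is_derive t 1 (fun s : R => s^-1) (- t^-1 ^+ 2).
    apply: (is_derive_eq (@is_deriveV R id t 1 1 (lt0r_neq0 t0) (is_derive_id _
      _))).
    by rewrite /GRing.scale /= mulr1 exprVn.
  have dN : is_derive t 1 (fun s : R => - s^-1) (t^-1 ^+ 2).
    by apply: is_derive_eq; rewrite opprK.
  have dE := @is_derive1_comp R expR (fun s : R =>
    - s^-1) t _ _ (is_derive_expR _) dN.
  have dX := @is_deriveX _ _ (fun s : R => s^-1) k t 1 _ dV.
  have Ef : (fun s : R => s^-1 ^+ k * expR (- s^-1)) = (fun s : R =>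
    s^-1) ^+ k * (expR \o (fun s : R => - s^-1)).
    by apply/funext => s; rewrite /GRing.mul /= exprfctE.
  rewrite Ef; apply: (is_derive_eq (is_deriveM dX dE)).
  rewrite /flat t0 /= exprfctE /GRing.scale /=.
  case: (k) => [|j] /=; rewrite !exprS ?expr0; ring.
- rewrite !flat_le0 ?ltW // mulr0 subr0.
  have E : \near t, cst 0 t = flat k t.
    by apply: filterS (lt_nbhsl t0) => s /ltW s0; rewrite flat_le0.
  exact: near_eq_is_derive E _.
rewrite !flat_le0 // mulr0 subr0.
have [C C0 fC] := flat_bound k.
have L : (fun h : R => h^-1 *: ((flat k \o shift 0) (h *: 1) - flat k 0)) @ 0^'
  --> (0 : R).
  (* [C] may be 0, so [C + 1] serves as the divisor. *)
  apply/cvgrPdist_lt => e e0; have C1 : 0 < C + 1 by rewrite ltr_wpDl.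
  near=> h.
  have h0 : h != 0 by near: h; exact: nbhs_dnbhs_neq.
  have hd : `|h| < e / (C + 1) by near: h; apply: dnbhs0_lt; exact: divr_gt0.
  rewrite /= sub0r normrN [flat k 0]flat_le0 // subr0 addr0 [h *: 1]mulr1
    normrZ normfV.
  rewrite ltr_pdivrMl ?normr_gt0 //; apply: le_lt_trans (fC h) _.
  rewrite -real_normK ?num_real // expr2 mulrCA ltr_pM2l ?normr_gt0 //.
  by apply: le_lt_trans (_ : (C + 1) * `|h| < e);
    [rewrite ler_wpM2r // lerDl|rewrite mulrC -ltr_pdivlMr].
by split; [apply/cvg_ex; exists 0|exact: cvg_lim].
Unshelve. all: by end_near.
Qed.

(** The derivative of [flat k] is a combination of [flat k.+2] and [flat k.+1], so the induction on
    the order is for all [k] at once. *)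
Lemma smooth_on_flat n (U : set 'rV[R]_n) f k : open U -> smooth_on U f ->
  smooth_on U (flat k \o f).
Proof.
move=> oU sf; apply/smooth_onP => N.
have dflat j t : differentiable (flat j) t.
  by apply/derivable1_diffP; have [] := is_derive_flat j t.
elim: N k => [|N IH] k; split => //;
  try by move=> x Ux; apply: differentiable_comp => //;
    exact: smooth_on_diff sf Ux.
move=> a; apply: (@eq_smooth_upto _ _ _ _
   ((flat k.+2 \o f + cst (- k%:R) * (flat k.+1 \o f)) * partial a f)) => //.
  move=> x; rewrite inE => Ux; have df := smooth_on_diff sf Ux.
  rewrite [RHS]partialE; last exact: differentiable_comp.
  rewrite diff_comp //= diff1E // -partialE //= derive1E.
  have [_ ->] := is_derive_flat k (f x).
  rewrite -[LHS]/((flat k.+2 (f x) + - k%:R * flat k.+1 (f x)) * partial a f x).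
  by rewrite mulNr mulrC.
have /smooth_onP pf := smooth_on_partial a sf.
apply: smooth_uptoM => //; apply: smooth_uptoD => //.
by apply: smooth_uptoM => //; exact: smooth_upto_cst.
Qed.

End Flat.

(** The function is flat(e - flat(q - s)) divided by flat(e), where q is the squared Euclidean
    distance to [p]. Where q <= s the inner term is 0 and the quotient is 1; where q >= r2^2 the
    inner term is at least e and the quotient is 0. [K] is a closed ball for the maximum norm,
    outside which one coordinate alone forces q >= r2^2. *)
Lemma bump_exists (R : realType) n (p : 'rV[R]_n) (U : set 'rV[R]_n) :
  open U -> U p ->
  exists (psi : 'rV[R]_n -> R) (K : set 'rV[R]_n),
    [/\ smooth_on setT psi, compact K, K `<=` U, (forall x, ~ K x -> psi x = 0) &
     \forall x \near p, psi x = 1].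
Proof.
move=> oU Up.
have /nbhs_ballP[r /= r0 Br] := open_nbhs_nbhs (conj oU Up).
pose q (x : 'rV[R]_n) : R := \sum_a (x 0 a - p 0 a) ^+ 2.
pose r2 := r / 2.
pose s := (r2 / 2) ^+ 2.
have r20 : 0 < r2 by rewrite divr_gt0.
pose e := flat 0 (r2 ^+ 2 - s).
have e0 : 0 < e.
  apply: flat_gt0; rewrite subr_gt0 /s ltrXn2r //= ?nnegrE ?divr_ge0 ?ltW //.
  by rewrite ltr_pdivrMr // ltr_pMr // ltr1n.
pose c := flat 0 e.
have c0 : 0 < c by exact: flat_gt0.
pose psi (x : 'rV[R]_n) := c^-1 * flat 0 (e - flat 0 (q x - s)).
have sq : smooth_on setT q.
  rewrite (_ : q = \sum_a (fun x : 'rV[R]_n => (x 0 a - p 0 a)) * (fun x =>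
    x 0 a - p 0 a)); last first.
    by apply/funext => x; rewrite fct_sumE.
  apply: smooth_on_sum => //; first exact: openT.
  move=> a _; have sa : smooth_on setT (fun x : 'rV[R]_n => x 0 a - p 0 a).
    by apply: smooth_onB; [exact: openT|exact: smooth_on_coord|exact:
      smooth_on_cst].
  by apply: smooth_onM => //; exact: openT.
have cq : continuous q by move=> x; apply: differentiable_continuous;
  exact: smooth_on_diff sq _.
exists psi, (closed_ball p r2); split.
- apply: (@smooth_onM _ _ _ (cst c^-1)); [exact: openT|exact: smooth_on_cst|].
  apply: (@smooth_on_flat _ _ _ (fun x => e - flat 0 (q x - s)));
    first exact: openT.
  apply: smooth_onB; [exact: openT|exact: smooth_on_cst|].
  apply: (@smooth_on_flat _ _ _ (fun x => q x - s)); first exact: openT.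
  by apply: smooth_onB; [exact: openT| |exact: smooth_on_cst].
- apply: bounded_closed_compact; last exact: closed_ball_closed.
  rewrite closed_ballE //; exists (`|p| + r2); split; first exact: num_real.
  move=> M pM x px; apply: le_trans (ltW pM).
  by rewrite -[x](subrKC p) (le_trans (ler_normD _ _)) // lerD2l distrC.
- move=> x; rewrite closed_ballE // => xK; apply: Br; rewrite -ball_normE /=.
  by apply: le_lt_trans xK _; rewrite /r2 ltr_pdivrMr // ltr_pMr // ltr1n.
- move=> x xK; rewrite /psi [flat 0 (e - _)]flat_le0 ?mulr0 // subr_le0.
  apply: flat0_le; rewrite lerD2r.
  rewrite leNgt; apply/negP => qx; apply: xK; rewrite closed_ballE //=.
  rewrite /closed_ball_ /= [leLHS]/Num.Def.normr /= mx_normrE.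
  rewrite (bigmax_le _ (ltW r20)) //= => -[i a] _; rewrite ord1 !mxE distrC /=.
  rewrite -ler_sqr ?nnegrE ?(ltW r20) //; apply: le_trans (ltW qx).
  by rewrite real_normK ?num_real // /q (bigD1 a) //= lerDl sumr_ge0 // => b _;
    exact: sqr_ge0.
have : \forall x \near p, q x < s.
  apply: (cvgr_lt _ (cq p)); rewrite /q big1 => [|a _];
    last by rewrite subrr expr0n.
  by rewrite exprn_gt0 // divr_gt0.
apply: filterS => x qs.
by rewrite /psi (@flat_le0 _ _ (q x - s)) ?subr_le0 ?ltW // subr0 mulVf // gt_eqF.
Qed.

(** * Jacobi's formula and the transformation of the Lie derivative *)

Section DeterminantDerivative.
Variables (R : realType) (n : nat).
Local Notation V := ('rV[R]_n).

Lemma differentiable_prod (I : Type) (r : seq I) (F : I -> V -> R) x :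
  (forall i, differentiable (F i) x) -> differentiable (\prod_(i <- r) F i) x.
Proof.
move=> dF; elim/big_ind: _ => //; by move=> f g; exact: differentiableM.
Qed.

Lemma partial_prod (I : eqType) (r : seq I) (F : I -> V -> R) a x : uniq r ->
  (forall i, differentiable (F i) x) ->
  partial a (\prod_(i <- r) F i) x =
  \sum_(k <- r) partial a (F k) x * \prod_(i <- r | i != k) F i x.
Proof.
move=> + dF; elim: r => [_|i r IH /= /andP[ir ur]].
  by rewrite !big_nil /partial (derive_cst (1 : R)).
rewrite !big_cons partialM //; last exact: differentiable_prod.
rewrite IH // eqxx addrC; congr (_ + _).
  rewrite mulrC; congr (_ * _).
  have -> : (\prod_(j <- r) F j) x = \prod_(j <- r) F j x by elim/big_rec2: _
    => // j _ y _ <-.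
  rewrite big_seq_cond [RHS]big_seq_cond; apply: eq_bigl => j.
  by have [->|] := eqVneq j i; rewrite ?(negbTE ir) ?andbT ?andbF.
rewrite big_distrr /= big_seq [RHS]big_seq; apply: eq_bigr => k kr.
rewrite big_cons; have [ki|_] := eqVneq i k; last by rewrite mulrCA.
by move: ir; rewrite ki kr.
Qed.

(** The Leibniz expansion is stated as an identity of functions, so that the rules for derivatives
    of sums and products apply to it. *)
Lemma detE m (A : V -> 'M[R]_m) : (fun y => \det (A y)) =
  \sum_(s : {perm (ordinal m)}) cst ((-1) ^+ s) * \prod_(i < m) (fun y =>
    A y i (s i)).
Proof.
apply/funext => y; rewrite fct_sumE; apply: eq_bigr => s _.
rewrite /GRing.mul /=; congr (_ * _).
by elim/big_rec2: _ => // i f g _ ->.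
Qed.

Lemma differentiable_bigsum (I : Type) (r : seq I) (F : I -> V -> R) x :
  (forall i, differentiable (F i) x) -> differentiable (\sum_(i <- r) F i) x.
Proof.
move=> dF; elim/big_ind: _ => //; by move=> f g; exact: differentiableD.
Qed.

Lemma partial_bigsum (I : Type) (r : seq I) (F : I -> V -> R) a x :
  (forall i, differentiable (F i) x) ->
  partial a (\sum_(i <- r) F i) x = \sum_(i <- r) partial a (F i) x.
Proof.
move=> dF; elim: r => [|i r IH];
  first by rewrite !big_nil /partial (derive_cst (0 : R)).
by rewrite !big_cons partialD ?IH //; exact: differentiable_bigsum.
Qed.

Lemma differentiable_det m (A : V -> 'M[R]_m) x :
  (forall i j, differentiable (fun y => A y i j) x) ->
  differentiable (fun y => \det (A y)) x.
Proof.
move=> dA; rewrite detE; apply: differentiable_bigsum => s.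
by apply: differentiableM => //; exact: differentiable_prod.
Qed.

(** Jacobi's formula: the derivative is the sum over [k] of the determinants in which row [k] alone
    is differentiated ([B k]), each then expanded along that row. *)
Lemma partial_det m (A : V -> 'M[R]_m) a x :
  (forall i j, differentiable (fun y => A y i j) x) ->
  partial a (fun y => \det (A y)) x =
  \sum_i \sum_j partial a (fun y => A y i j) x * cofactor (A x) i j.
Proof.
move=> dA; have dP (s : {perm 'I_m}) : differentiable (\prod_(i < m) (fun y =>
  A y i (s i))) x.
  by apply: differentiable_prod.
rewrite detE partial_bigsum; last by move=> s; exact: differentiableM.
pose B k := \matrix_(i, j) if i == k then partial a (fun y =>
  A y i j) x else A x i j.
transitivity (\sum_k \det (B k)).
  rewrite /determinant exchange_big /=; apply: eq_bigr => s _.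
  rewrite partialM // /partial (derive_cst ((-1) ^+ s : R)) mulr0 addr0.
  rewrite -/(partial _ _ _) partial_prod ?index_enum_uniq // big_distrr /=.
  apply: eq_bigr => k _; congr (_ * _); rewrite [RHS](bigD1 k) //= mxE eqxx;
    congr (_ * _).
  by apply: eq_bigr => i ik; rewrite mxE (negbTE ik).
apply: eq_bigr => k _; rewrite (expand_det_row _ k); apply: eq_bigr => j _.
rewrite mxE eqxx; congr (_ * _); rewrite /cofactor; congr (_ * \det _).
by apply/matrixP => i l; rewrite !mxE eq_sym (negbTE (neq_lift k i)).
Qed.

End DeterminantDerivative.

Section LieDerivative.
Variables (R : realType) (n : nat).
Local Notation V := ('rV[R]_n).

Definition lie (X : V -> V) (L : V -> R) (x : V) : R :=
  'd L x (X x) - L x * \sum_(a < n) partial a (fun y => X y 0 a) x.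

(** Differentiating L' o T = det J . L along X gives the first term of the Lie derivative, with an
    extra L . X(det J). Differentiating X' o T = X J gives J D = DX J + Q, with D and DX the
    derivative matrices of X' and X, and Q the derivative of J along X. Multiplying by the inverse
    of J and taking traces, the divergence acquires tr(adj J . Q) / det J, whose numerator is X(det
    J) by Jacobi's formula, and the extra terms cancel. *)
Lemma lie_transform (U U' : set V) (T X X' : V -> V) (L L' : V -> R) x :
  open U -> U x -> smooth_map_on U T -> (forall y, U y -> U' (T y)) ->
  smooth_map_on U X -> smooth_on U L -> smooth_map_on U' X' -> smooth_on U' L' ->
  (forall y, U y -> X' (T y) = X y *m 'J T y) ->
  (forall y, U y -> L' (T y) = \det ('J T y) * L y) ->
  \det ('J T x) != 0 ->
  lie X' L' (T x) = \det ('J T x) * lie X L x.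
Proof.
move=> oU Ux sT TU sX sL sX' sL' XT LT detJ.
have dT y : U y -> differentiable T y by move=> Uy; exact: smooth_map_diff sT Uy.
(* The entries of this [J] are partial derivatives by definition, at every point; it agrees with the
   Jacobian of [T] on [U]. *)
pose J y : 'M[R]_n := \matrix_(a, b) partial a (fun z => T z 0 b) y.
have JE y : U y -> 'J T y = J y.
  by move=> Uy; apply/matrixP => a b; rewrite jacobianE ?mxE //; exact: dT.
have dJ y a b : U y -> differentiable (fun y => J y a b) y.
  move=> Uy; rewrite (_ : (fun y => J y a b) = partial a (fun z => T z 0 b)).
    exact: smooth_on_diff (smooth_on_partial a (sT b)) Uy.
  by apply/funext => z; rewrite mxE.
have dX y a : U y -> differentiable (fun y => X y 0 a) y.
  by move=> Uy; exact: smooth_on_diff (sX a) Uy.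
have dL : differentiable L x by exact: smooth_on_diff sL Ux.
have dL' : differentiable L' (T x) by apply: smooth_on_diff sL' _; exact: TU.
have dX' a : differentiable (fun y =>
  X' y 0 a) (T x) by apply: smooth_on_diff (sX' a) _; exact: TU.
have ddet : differentiable (fun y =>
  \det (J y)) x by apply: differentiable_det => i j; exact: dJ.
have first_term : 'd L' (T x) (X' (T x)) =
    \det (J x) * 'd L x (X x) + L x * 'd (fun y => \det (J y)) x (X x).
  rewrite XT // -diff_jacobian.
  rewrite -[LHS]/(('d L' (T x) \o 'd T x) (X x)) -diff_comp;
    [|exact: dT|exact: dL'].
  have E : {near x, (fun y => \det (J y)) * L =1 L' \o T}.
    apply: (open_near_eq oU Ux) => y; rewrite inE => Uy.
    by rewrite /= LT // JE.
  have [_ ->] := near_eq_diff E (differentiableM ddet dL).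
  by rewrite diffM.
pose D : 'M[R]_n := \matrix_(c, b) partial c (fun y => X' y 0 b) (T x).
pose DX : 'M[R]_n := \matrix_(a, d) partial a (fun y => X y 0 d) x.
pose Q : 'M[R]_n := \matrix_(a, b) \sum_d X x 0 d * partial d (fun y =>
  J y a b) x.
have JD : J x *m D = DX *m J x + Q.
  apply/matrixP => a b; rewrite !mxE -big_split /=.
  transitivity (partial a ((fun y => X' y 0 b) \o T) x).
    rewrite partial_comp //; last exact: dT.
    by apply: eq_bigr => c _; rewrite JE // [D _ _]mxE.
  rewrite (@near_eq_partial _ _ _ (\sum_d (fun y => X y 0 d) * (fun y =>
    J y d b))); last first.
    apply: (open_near_eq oU Ux) => y; rewrite inE => Uy.
    by rewrite /= XT // mxE fct_sumE JE.
  rewrite partial_bigsum => [|d]; last by apply: differentiableM;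
    [exact: dX|exact: dJ].
  apply: eq_bigr => d _; rewrite partialM; [|exact: dX|exact: dJ].
  rewrite addrC !mxE [partial d _ x * partial a _ x]mulrC; congr (_ * _ + _ * _).
  (* The two sides differ in the order of the derivatives of the b-th component of [T]; this is
     where symmetry enters. *)
  have jE a' b' : (fun y => J y a' b') = partial a' (fun z => T z 0 b').
    by apply/funext => z; rewrite mxE.
  by rewrite !jE; apply: partial_symmetric oU (sT b) Ux.
have divE : \sum_b partial b (fun y =>
  X' y 0 b) (T x) = \tr D by apply: eq_bigr => b _; rewrite mxE.
have Ju : J x \in unitmx by rewrite unitmxE unitfE -JE.
have trD : \det (J x) * \tr D = \det (J x) * \tr DX + 'd (fun y =>
  \det (J y)) x (X x).
  rewrite -[D](mulKmx Ju) JD mulmxDr mxtraceD mxtrace_mulC mulmxK // mulrDr;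
    congr (_ + _).
  rewrite diff_partial //.
  transitivity (\tr (\adj (J x) *m Q)).
    by rewrite /invmx Ju -scalemxAl mxtraceZ mulrA divff ?mul1r // -unitfE
      -unitmxE.
  transitivity (\sum_d \sum_i \sum_j X x 0 d * (partial d (fun y =>
    J y i j) x * cofactor (J x) i j)).
    rewrite /mxtrace exchange_big /=.
    under [RHS]eq_bigr do rewrite exchange_big /=.
    rewrite exchange_big /=; apply: eq_bigr => j _; rewrite mxE;
      apply: eq_bigr => i _.
    by rewrite !mxE big_distrr /=; apply: eq_bigr => d _; rewrite mulrC -mulrA.
  apply: eq_bigr => d _; rewrite partial_det; last by move=> i j; exact: dJ.
  by rewrite big_distrr /=; apply: eq_bigr => i _; rewrite big_distrr.
have divE' : \sum_a partial a (fun y =>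
  X y 0 a) x = \tr DX by apply: eq_bigr => b _; rewrite mxE.
have lieE : lie X L x = 'd L x (X x) - L x * \tr DX.
  exact (f_equal (fun s => 'd L x (X x) - L x * s) divE').
have lieE' := f_equal2 (fun s t =>
  s - t) first_term (f_equal2 *%R (LT x Ux) divE).
rewrite lieE (JE x Ux); rewrite (JE x Ux) in lieE'; apply: (etrans lieE').
have algE (a b c d e f : R) : a * d = a * e + f -> a * b + c * f - a * c * d =
  a * (b - c * e).
  by move=> E; rewrite mulrAC E; ring.
exact: algE trD.
Qed.

End LieDerivative.

Lemma near_eq_lie (R : realType) n (X Y : 'rV[R]_n -> 'rV[R]_n) (L : 'rV[R]_n
  -> R) x :
  {near x, X =1 Y} -> lie X L x = lie Y L x.
Proof.
move=> XY; rewrite /lie (nbhs_singleton XY); congr (_ - _ * _);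
  apply: eq_bigr => a _.
by apply: near_eq_partial; apply: filterS XY => y ->.
Qed.

Lemma jacobian_comp (R : realType) n m l (F : 'rV[R]_n -> 'rV[R]_m)
    (G : 'rV[R]_m -> 'rV[R]_l) x :
  differentiable F x -> differentiable G (F x) ->
  'J (G \o F) x = 'J F x *m 'J G (F x).
Proof.
move=> dF dG; apply/matrixP => a b.
transitivity (((delta_mx 0 a : 'rV[R]_n) *m ('J F x *m 'J G (F x))) 0 b);
  last by rewrite -rowE [LHS]mxE.
by rewrite [LHS]mxE (diff_comp dF dG) /= (diff_jacobian F) (diff_jacobian G)
  mulmxA.
Qed.

Lemma near_eq_jacobian (R : realType) n m (F G : 'rV[R]_n -> 'rV[R]_m) x :
  {near x, F =1 G} -> differentiable F x -> 'J G x = 'J F x.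
Proof.
move=> FG dF; have [_ E] := near_eq_diff FG dF.
apply/matrixP => a b; rewrite /jacobian [LHS]mxE [RHS]mxE.
exact (f_equal (fun h : 'rV[R]_n -> 'rV[R]_m => h (delta_mx 0 a) 0 b) E).
Qed.

(** * Extension by zero from a chart *)

Section ChartTopology.
Variables (R : realType) (n : nat) (T : topologicalType).
Implicit Types c d e : chart R n T.

Lemma open_cod_preimage c (O : set T) : open O -> open (cod c `&` param c @^-1`
  O).
Proof.
move=> oO; rewrite openE => x [cx Ox]; apply: filterI.
  by apply: open_nbhs_nbhs; split => //; exact: open_cod.
by apply: (param_continuous cx); exact: open_nbhs_nbhs.
Qed.

Lemma open_overlap c d : open (overlap c d).
Proof. exact: open_cod_preimage (open_dom d). Qed.

Lemma overlap_transition c d x : overlap c d x -> overlap d c (transition c d x).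
Proof.
move=> [cx dx]; split; first exact: coord_cod.
by rewrite /transition /= coordK //; exact: param_dom.
Qed.

Lemma param_transition c d x : overlap c d x -> param d (transition c d x) =
  param c x.
Proof. by move=> [cx dx]; rewrite /transition /= coordK. Qed.

Lemma transitionK c d x : overlap c d x -> transition d c (transition c d x) = x.
Proof. by move=> cdx; rewrite /transition /= param_transition // paramK //;
  case: cdx. Qed.

Lemma transition_comp c d e x : overlap c d x ->
  transition d e (transition c d x) = transition c e x.
Proof. by move=> cdx; rewrite {1 3}/transition /= param_transition. Qed.

Lemma transition_id c x : cod c x -> transition c c x = x.
Proof. by move=> cx; rewrite /transition /= paramK. Qed.

Lemma overlap_id c x : cod c x -> overlap c c x.
Proof. by move=> cx; split => //; exact: param_dom. Qed.

(** The image of [K] is compact, hence closed in the Hausdorff space [T]. This closedness in all of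
    [T], not just in the chart domain, is what makes extension by zero smooth. *)
Lemma open_off_compact c d (K : set 'rV[R]_n) : hausdorff_space T ->
  compact K -> K `<=` cod c -> open (cod d `&` param d @^-1` (~` (param c @` K))).
Proof.
move=> hT cK Kc; apply: open_cod_preimage; apply: closed_openC;
  apply: (compact_closed hT).
apply: (@continuous_compact _ T (param c)) => //.
apply: continuous_in_subspaceT => x; rewrite inE => Kx.
by apply: param_continuous; exact: Kc.
Qed.

Lemma transition_off_compact c d (K : set 'rV[R]_n) y :
  overlap d c y -> (~` (param c @` K)) (param d y) -> ~ K (transition d c y).
Proof. by move=> dcy H Ky; apply: H; exists (transition d c y) => //;
  rewrite param_transition. Qed.

End ChartTopology.

Section Extension.
Variables (R : realType) (n : nat) (M : smooth_manifold R n).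
Local Notation V := ('rV[R]_n).
Local Notation I := (atlas_index M).
Variables (i : I) (K : set V).
Hypotheses (cK : compact K) (Kcod : K `<=` cod (atlas i)).

Lemma transition_diff (j k : I) x : overlap (atlas j) (atlas k) x ->
  differentiable (transition (atlas j) (atlas k)) x.
Proof. by move=> jkx; exact: smooth_map_diff (@atlas_smooth _ _ M j k) jkx. Qed.

Lemma jacobian_transition (j k l : I) x : overlap (atlas j) (atlas k) x ->
  dom (atlas l) (param (atlas j) x) ->
  'J (transition (atlas j) (atlas l)) x =
  'J (transition (atlas j) (atlas k)) x *m
  'J (transition (atlas k) (atlas l)) (transition (atlas j) (atlas k) x).
Proof.
move=> jkx lx.
have klx : overlap (atlas k) (atlas l) (transition (atlas j) (atlas k) x).
  by split; [apply: coord_cod;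
    case: jkx|rewrite /preimage /mkset param_transition].
rewrite -(jacobian_comp (transition_diff jkx) (transition_diff klx)).
have E : {near x, transition (atlas k) (atlas l) \o transition (atlas j) (atlas k)
    =1 transition (atlas j) (atlas l)}.
  apply: (open_near_eq (@open_overlap _ _ _ (atlas j) (atlas k)) jkx) => y;
    rewrite inE => jky.
  exact: transition_comp.
apply: (near_eq_jacobian E).
exact: (differentiable_comp (transition_diff jkx) (transition_diff klx)).
Qed.

Lemma jacobian_transition_id x : cod (atlas i) x ->
  'J (transition (atlas i) (atlas i)) x = 1%:M.
Proof.
move=> cx; have nx : nbhs x (cod (atlas i)) by apply: open_nbhs_nbhs;
  split => //; exact: open_cod.
have E : {near x, (fun y : V => y) =1 transition (atlas i) (atlas i)}.
  apply: filterS nx => y cy.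
  by rewrite transition_id.
have did : is_diff x (id : V -> V) id by exact: is_diff_id.
rewrite (near_eq_jacobian E) //; apply/matrixP => a b;
  rewrite /jacobian mxE diff_val.
by rewrite !mxE eq_sym.
Qed.

Lemma open_off_support (j : I) :
  open (cod (atlas j) `&` param (atlas j) @^-1` (~` (param (atlas i) @` K))).
Proof. exact: open_off_compact (@manifold_hausdorff _ _ M) cK Kcod. Qed.

(** Both sets are open, so smoothness of an extension by zero can be checked on each: on the first
    it is transported from chart [i], on the second it vanishes. *)
Lemma overlap_or_off_support (j : I) y : cod (atlas j) y ->
  overlap (atlas j) (atlas i) y \/
  (cod (atlas j) `&` param (atlas j) @^-1` (~` (param (atlas i) @` K))) y.
Proof.
move=> cy; have [d|nd] := pselect (dom (atlas i) (param (atlas j) y));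
  first by left.
by right; split => // -[x /Kcod Kx xy]; apply: nd; rewrite -xy; exact: param_dom.
Qed.

Definition extend_fun (f : V -> R) (p : M) : R :=
  if p \in dom (atlas i) then f (Defs.coord (atlas i) p) else 0.

Lemma extend_funE f x : cod (atlas i) x -> extend_fun f (param (atlas i) x) = f x.
Proof. by move=> cx; rewrite /extend_fun mem_set ?paramK //;
  exact: param_dom. Qed.

Lemma smooth_extend_fun f : smooth_on (cod (atlas i)) f -> (forall x,
  ~ K x -> f x = 0) ->
  smooth_fun (extend_fun f).
Proof.
move=> sf f0 j; apply: smooth_on_local => y /overlap_or_off_support[ijy|offy].
  exists (overlap (atlas j) (atlas i)) => //.
  apply: (@eq_smooth_on _ _ _ (f \o transition (atlas j) (atlas i))).
  - exact: open_overlap.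
  - by move=> z; rewrite inE => -[_ zd]; rewrite /extend_fun /= mem_set.
  apply: smooth_on_comp sf; [exact: open_overlap| |exact: atlas_smooth].
  by move=> z /overlap_transition[].
eexists; first exact: offy.
apply: (@eq_smooth_on _ _ _ (cst 0));
  [exact: open_off_support| |exact: smooth_on_cst].
move=> z; rewrite inE => -[cz oz]; rewrite /extend_fun /=.
have [d|//] := boolP (_ \in _); rewrite f0 //; apply: transition_off_compact oz.
by split => //; rewrite inE in d.
Qed.

Definition extend_vfield (X : V -> V) : vfield_data M := fun j y =>
  if y \in overlap (atlas j) (atlas i)
  then X (transition (atlas j) (atlas i) y) *m
    'J (transition (atlas i) (atlas j)) (transition (atlas j) (atlas i) y)
  else 0.

Variable X : V -> V.
Hypotheses (sX : smooth_map_on (cod (atlas i)) X) (X0 : forall x,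
  ~ K x -> X x = 0).

Lemma extend_vfieldE x : cod (atlas i) x -> extend_vfield X i x = X x.
Proof.
move=> cx; rewrite /extend_vfield mem_set; last exact: overlap_id.
by rewrite transition_id // jacobian_transition_id // mulmx1.
Qed.

Lemma extend_vfield_off j y :
  (cod (atlas j) `&` param (atlas j) @^-1` (~` (param (atlas i) @` K))) y ->
  extend_vfield X j y = 0.
Proof.
move=> [cy oy]; rewrite /extend_vfield; have [d|//] := boolP (_ \in _).
rewrite X0 ?mul0mx //; apply: transition_off_compact oy; by rewrite inE in d.
Qed.

Lemma vector_field_extend : vector_field (extend_vfield X).
Proof.
split.
- move=> j b; apply: smooth_on_local => y /overlap_or_off_support[jiy|offy];
    last first.
    eexists; first exact: offy.
    apply: (@eq_smooth_on _ _ _ (cst 0));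
      [exact: open_off_support| |exact: smooth_on_cst].
    by move=> z; rewrite inE => /extend_vfield_off ->; rewrite mxE.
  exists (overlap (atlas j) (atlas i)) => //.
  have oji := @open_overlap _ _ _ (atlas j) (atlas i).
  apply: (@eq_smooth_on _ _ _ (\sum_a ((fun x =>
    X x 0 a) \o transition (atlas j) (atlas i)) *
    (partial a (fun x => transition (atlas i) (atlas j) x 0 b) \o transition
      (atlas j) (atlas i)))) => //.
    move=> z; rewrite inE => jiz; rewrite /extend_vfield mem_set // mxE fct_sumE.
    apply: eq_bigr => a _; rewrite jacobianE //; apply: transition_diff.
    exact: overlap_transition.
  apply: smooth_on_sum => // a _; apply: smooth_onM => //.
    apply: smooth_on_comp (sX a) => //; last exact: atlas_smooth.
    by move=> z /overlap_transition[].
  apply: (@smooth_on_comp _ _ _ _ (overlap (atlas i) (atlas j))) => //.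
  + exact: overlap_transition.
  + exact: atlas_smooth.
  by apply: smooth_on_partial; exact: atlas_smooth.
- move=> j k y jky; rewrite /extend_vfield.
  have kjz := overlap_transition jky.
  have pE := param_transition jky.
  (* In a triple overlap the rule is the cocycle identity of the Jacobians; otherwise the point is
     outside chart [i] and both sides are 0. *)
  have [jiy|njiy] := pselect (overlap (atlas j) (atlas i) y).
    have kiz : overlap (atlas k) (atlas i) (transition (atlas j) (atlas k) y).
      by split; [case: kjz|rewrite /preimage /mkset pE; case: jiy].
    have ijw := overlap_transition jiy.
    have dk : dom (atlas k) (param (atlas i) (transition (atlas j) (atlas i) y)).
      by rewrite (param_transition jiy); case: jky.
    have Jc := jacobian_transition ijw dk; rewrite (transitionK jiy) in Jc.
    rewrite (mem_set jiy).
    rewrite (mem_set kiz).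
    rewrite (transition_comp (atlas i) jky).
    apply: (etrans _ (mulmxA _ _ _)).
    exact: (f_equal (mulmx _) Jc).
  have nkiz : ~ overlap (atlas k) (atlas i) (transition (atlas j) (atlas k) y).
    move=> -[_]; rewrite /preimage /mkset pE => d.
    by apply: njiy; split => //; case: jky.
  by rewrite (memNset njiy) (memNset nkiz) mul0mx.
move=> j x ncx; rewrite /extend_vfield memNset // => -[].
by move=> /ncx.
Qed.

(** On the overlap with chart [i] the Lie derivative is a multiple of the one computed there, by
    [lie_transform], the orientation making the Jacobian invertible; off the support the field is
    zero near the point. *)
Lemma cocycle_extend (L : nvector_data M) : oriented_manifold M ->
  nvector_field L ->
  (forall x, cod (atlas i) x -> lie X (L i) x = 0) ->
  nambu_cocycles L (extend_vfield X).
Proof.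
move=> oM [sL tL _] lie0; have vf := vector_field_extend; split => // j y cy.
rewrite -[LHS]/(lie (extend_vfield X j) (L j) y).
have [jiy|offy] := overlap_or_off_support cy; last first.
  rewrite (@near_eq_lie _ _ _ (cst 0)); last first.
    apply: (open_near_eq (@open_off_support j) offy) => z;
      rewrite inE => /extend_vfield_off.
    exact.
  rewrite /lie linear0 big1 ?mulr0 ?subr0 // => a _.
  by rewrite (_ : (fun _ => _) = cst 0) ?/partial ?derive_cst //;
    apply/funext => z; rewrite mxE.
have ijw := overlap_transition jiy; have [cw _] := ijw.
(* The point is written as the image of its own coordinates in chart [i], so that [lie_transform]
   applies to the transition from [i] to [j]. *)
rewrite -[y in LHS](transitionK jiy).
have [sXe tXe _] := vf.
rewrite (@lie_transform _ _ (overlap (atlas i) (atlas j)) (cod (atlas j)) _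
  (extend_vfield X i) _ (L i)) //.
- rewrite (@near_eq_lie _ _ _ X) ?lie0 ?mulr0 //.
  have nw : nbhs (transition (atlas j) (atlas i) y) (cod (atlas i)).
    by apply: open_nbhs_nbhs; split => //; exact: open_cod.
  by apply: filterS nw => z; exact: extend_vfieldE.
- exact: open_overlap.
- exact: atlas_smooth.
- by move=> z /overlap_transition[].
- by move=> b; apply: smooth_on_sub (sXe i b) => z [].
- by apply: smooth_on_sub (sL i) => z [].
- by move=> z; exact: tXe.
- by move=> z; exact: tL.
by rewrite gt_eqF //; exact: oM.
Qed.

End Extension.

Lemma partialB (R : realType) n (f g : 'rV[R]_n -> R) a x :
  differentiable f x -> differentiable g x ->
  partial a (f - g) x = partial a f x - partial a g x.
Proof. by move=> df dg; rewrite /partial deriveB //; apply: diff_derivable. Qed.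

(** * The cocycles *)

Section CrossProduct.
Variables (R : realType) (n : nat).
Local Notation V := ('rV[R]_n).
Variables (h f : V -> R) (a b c : 'I_n).
Hypotheses (ab : a != b) (ac : a != c) (bc : b != c).

Let wedge (d e : 'I_n) : V -> R :=
  partial d h * partial e f - partial e h * partial d f.

(* The field X with i_X(dx_1 /\ ... /\ dx_n) = dh /\ df /\ (the remaining dx_d),
   up to sign. *)
Definition cross (x : V) : V :=
  wedge b c x *: delta_mx 0 a + wedge c a x *: delta_mx 0 b
  + wedge a b x *: delta_mx 0 c.

Lemma crossE x : [/\ cross x 0 a = wedge b c x, cross x 0 b = wedge c a x,
  cross x 0 c = wedge a b x &
  forall e, e != a -> e != b -> e != c -> cross x 0 e = 0].
Proof.
have [ba ca cb] : [/\ b != a, c != a & c != b] by split; rewrite eq_sym.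
rewrite /cross; move: (wedge b c x) (wedge c a x) (wedge a b x) => p q r.
split=> [|||e /negbTE ea /negbTE eb /negbTE ec]; rewrite !mxE !eqxx /=.
- by rewrite (negbTE ab) (negbTE ac) mulr1 !mulr0 !addr0.
- by rewrite (negbTE ba) (negbTE bc) mulr1 !mulr0 addr0 add0r.
- by rewrite (negbTE ca) (negbTE cb) mulr1 !mulr0 !add0r.
by rewrite ea eb ec !mulr0 !addr0.
Qed.

Lemma sum3 (F : 'I_n -> R) : (forall e, e != a -> e != b -> e != c -> F e = 0) ->
  \sum_e F e = F a + F b + F c.
Proof.
move=> F0; rewrite (bigD1 a) //= (bigD1 b) 1?eq_sym //= (bigD1 c) /=; last first.
  by rewrite eq_sym ac eq_sym.
rewrite big1 ?addr0 ?addrA // => e /andP[/andP[ea eb] ec]; exact: F0.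
Qed.

Lemma cross_off (K : set V) : closed K -> (forall x, ~ K x -> f x = 0) ->
  forall x, ~ K x -> cross x = 0.
Proof.
move=> clK f0 x nKx.
have pf0 d : partial d f x = 0.
  have nx : nbhs x (~` K) by apply: open_nbhs_nbhs; split => //;
    exact: closed_openC.
  rewrite (@near_eq_partial _ _ _ (cst 0)); first by rewrite /partial derive_cst.
  by apply: filterS nx => y; exact: f0.
have w0 d e : wedge d e x = 0.
  by rewrite -[LHS]/(partial d h x * partial e f x - partial e h x * partial d
    f x) !pf0 !mulr0 subr0.
by rewrite /cross !w0 !scale0r !addr0.
Qed.

Variable U : set V.
Hypotheses (oU : open U) (sh : smooth_on U h) (sf : smooth_on U f).

Lemma smooth_wedge d e : smooth_on U (wedge d e).
Proof. by apply: smooth_onB => //; apply: smooth_onM => //;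
  exact: smooth_on_partial. Qed.

Lemma smooth_cross : smooth_map_on U cross.
Proof.
move=> e; have [->|ea] := eqVneq e a.
  apply: eq_smooth_on (smooth_wedge b c) => // x _;
    by have [-> _ _ _] := crossE x.
have [->|eb] := eqVneq e b.
  apply: eq_smooth_on (smooth_wedge c a) => // x _;
    by have [_ -> _ _] := crossE x.
have [->|ec] := eqVneq e c.
  apply: eq_smooth_on (smooth_wedge a b) => // x _;
    by have [_ _ -> _] := crossE x.
apply: eq_smooth_on (@smooth_on_cst _ _ U 0) => // x _.
by have [_ _ _ ->] := crossE x.
Qed.

(** In the coordinates a, b, c the field is the cross product of the gradients of [h] and [f]: it is
    orthogonal to the gradient of [h], and its divergence cancels by symmetry of second
    derivatives. *)
Lemma lie_cross x : U x -> lie cross h x = 0.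
Proof.
move=> Ux; have dh := smooth_on_diff sh Ux.
have wE d e y : wedge d e y = partial d h y * partial e f y - partial e h y *
  partial d f y by [].
have [Ea Eb Ec E0] := crossE x.
have dir0 : 'd h x (cross x) = 0.
  rewrite diff_partial // sum3; last by move=> e ea eb ec; rewrite E0 // mul0r.
  have alg (p q r s t v : R) :
    (q * v - r * t) * p + (r * s - p * v) * q + (p * t - q * s) * r = 0 by ring.
  by rewrite Ea Eb Ec; exact: alg.
have dp g d : smooth_on U g -> differentiable (partial d g) x.
  by move=> sg; exact: smooth_on_diff (smooth_on_partial d sg) Ux.
have dw d e s : partial s (wedge d e) x = partial d h x * partial s (partial e
  f) x
   + partial e f x * partial s (partial d h) x
   - (partial e h x * partial s (partial d f) x + partial d f x * partial s
       (partial e h) x).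
  rewrite /wedge partialB; [|by apply: differentiableM; exact: dp..].
  by rewrite (partialM s (dp h d sh) (dp f e sf)) (partialM s (dp h e sh) (dp f
    d sf)).
have div0 : \sum_s partial s (fun y => cross y 0 s) x = 0.
  rewrite sum3 => [|e ea eb ec]; last first.
    rewrite (_ : (fun y => cross y 0 e) = cst 0) ?/partial ?derive_cst //.
    by apply/funext => y; have [_ _ _ ->] := crossE y.
  have -> : (fun y => cross y 0 a) = wedge b c by apply/funext => y;
    have [-> _ _ _] := crossE y.
  have -> : (fun y => cross y 0 b) = wedge c a by apply/funext => y;
    have [_ -> _ _] := crossE y.
  have -> : (fun y => cross y 0 c) = wedge a b by apply/funext => y;
    have [_ _ -> _] := crossE y.
  have sym g d e : smooth_on U g -> partial d (partial e g) x = partial e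
    (partial d g) x.
    by move=> sg; exact: partial_symmetric oU sg Ux.
  (* Here p, q, r and s, t, v are the derivatives of [h] and [f] along a, b, c, and [fab] stands for
     [partial a (partial b f)]. *)
  have alg (p q r s t v fab fba fac fca fbc fcb hab hba hac hca hbc hcb : R) :
      fba = fab -> fca = fac -> fcb = fbc -> hba = hab -> hca = hac -> hcb =
        hbc ->
      (q * fac + v * hab - (r * fab + t * hac)) +
      (r * fba + s * hbc - (p * fbc + v * hba)) +
      (p * fcb + t * hca - (q * fca + s * hcb)) = 0.
    by do 6 move=> ->; ring.
  rewrite (dw b c a) (dw c a b) (dw a b c).
  exact: alg (sym f b a sf) (sym f c a sf) (sym f c b sf) (sym h b a sh) (sym h
    c a sh) (sym h c b sh).
by rewrite /lie dir0 div0 mulr0 subr0.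
Qed.

End CrossProduct.

(** * Zeros near a transverse zero, and linear dependence *)

(** An existence form of the implicit function theorem. [D * h] increases along [u], so it has
    opposite signs at the ends of a segment through [x0]; the signs persist after a small shift
    along [v], and the intermediate value theorem gives a zero. The factor [D] treats both signs of
    the derivative together. *)
Lemma zeros_along (R : realType) (V : normedModType R) (h : V -> R) (x0 u v :
  V) (r D : R) :
  0 < r -> (forall y, `|y - x0| < r -> differentiable h y) ->
  (forall y, `|y - x0| < r -> 0 < D * 'D_u h y) -> h x0 = 0 ->
  exists2 d : R, 0 < d & forall t, 0 <= t < d ->
    exists2 s, `|x0 + s *: u + t *: v - x0| < r & h (x0 + s *: u + t *: v) = 0.
Proof.
move=> r0 dh Dh h0.
pose A := `|u| + `|v| + 1.
have A0 : 0 < A by rewrite ltr_wpDl // addr_ge0.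
(* With this bound on both parameters every point considered stays in the ball of radius [r]. *)
pose s0 := r / A.
have s00 : 0 < s0 by rewrite divr_gt0.
have sA : s0 * (`|u| + `|v|) < r by rewrite /s0 mulrAC ltr_pdivrMr // ltr_pM2l
  // /A ltrDl.
have near_x0 s t : `|s| <= s0 -> `|t| <= s0 -> `|x0 + s *: u + t *: v - x0| < r.
  move=> ss ts; rewrite -(addrA x0) [X in `|X|]addrC addKr.
  apply: le_lt_trans sA; apply: (le_trans (ler_normD _ _)).
  by rewrite !normrZ mulrDr lerD // ler_wpM2r.
have near_x0' s : `|s| <= s0 -> `|x0 + s *: u - x0| < r.
  by move=> ss; have := near_x0 s 0 ss; rewrite scale0r addr0 normr0 ltW //;
    apply.
have pos : 0 < D * h (x0 + s0 *: u).
  have [s|s /andP[s1 s2]] := @MVT_line _ _ h x0 u s0 s00.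
    by move=> /andP[s1 s2]; apply: dh; apply: near_x0'; rewrite ger0_norm.
  rewrite h0 subr0 => ->; rewrite mulrCA mulr_gt0 // Dh //.
  by apply: near_x0'; rewrite ger0_norm.
have neg : D * h (x0 + (- s0) *: u) < 0.
  have B s : 0 <= s <= s0 -> `|x0 + (- s0) *: u + s *: u - x0| < r.
    move=> /andP[s1 s2]; rewrite -(addrA x0) -scalerDl; apply: near_x0'.
    by rewrite ler_norml lerDl s1 /= addrC lerBlDr ler_wpDr // ltW.
  have [s|s sI] := @MVT_line _ _ h (x0 + (- s0) *: u) u s0 s00.
    by move=> sI; apply: dh; exact: B.
  rewrite scaleNr subrK h0 sub0r -scaleNr => E.
  by rewrite -oppr_gt0 -mulrN E mulrCA mulr_gt0 // Dh // B.
have ct s : `|s| <= s0 -> (fun t =>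
  D * h (x0 + s *: u + t *: v)) @ (0 : R) --> D * h (x0 + s *: u).
  move=> ss; have dl : differentiable h (x0 + s *: u + 0 *: v) by rewrite
    scale0r addr0; exact/dh/near_x0'.
  have [dc _] := is_derive_line dl.
  have hc : {for (0 : R), continuous (fun t : R => h (x0 + s *: u + t *: v) : R)}.
    by apply: differentiable_continuous; apply/derivable1_diffP.
  have <- : h (x0 + s *: u + 0 *: v) = h (x0 + s *: u) by rewrite scale0r addr0.
  by apply: cvgM hc; exact: cvg_cst.
have ns0 : `|s0| <= s0 by rewrite ger0_norm // ltW.
have nNs0 : `|- s0| <= s0 by rewrite normrN.
have near1 : \forall t \near (0 : R), 0 < D * h (x0 + s0 *: u + t *: v).
  exact: (cvgr_gt _ (ct _ ns0)).
have near2 : \forall t \near (0 : R), D * h (x0 + (- s0) *: u + t *: v) < 0.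
  exact: (cvgr_lt _ (ct _ nNs0)).
have := @filterI _ (nbhs (0 : R)) (nbhs_filter _) _ _ near1 near2.
move/nbhs_ballP => [d /= d0 Bd].
exists (Num.min d s0); first by rewrite lt_min d0.
move=> t /andP[t0]; rewrite lt_min => /andP[td ts].
have nt : `|t| <= s0 by rewrite ger0_norm // ltW.
have [p1 p2] : 0 < D * h (x0 + s0 *: u + t *: v) /\ D * h (x0 + (- s0) *: u + t
  *: v) < 0.
  by apply: Bd; rewrite /ball /= sub0r normrN ger0_norm.
have D0 : D != 0 by apply/eqP => D0; rewrite D0 mul0r ltxx in p1.
have [||| s sI sE] := @IVT R (fun s => D * h (x0 + s *: u + t *: v)) (- s0) s0 0.
- by rewrite ge0_cp // ltW.
- apply: derivable_within_continuous => s; rewrite in_itv /= -ler_norml => ss.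
  have dl : differentiable h (x0 + t *: v + s *: u) by apply: dh;
    rewrite (addrAC x0); exact: near_x0.
  have [dc _] := is_derive_line dl.
  rewrite (_ : (fun s => _) = (fun s => D * h (x0 + t *: v + s *: u)));
    last first.
    by apply/funext => q; rewrite addrAC.
  exact: (@derivableZ _ _ _ _ D).
- by rewrite ge_min le_max (ltW p1) (ltW p2) orbT.
exists s; first by apply: near_x0 => //; rewrite ler_norml; move: sI;
  rewrite in_itv.
by apply/eqP; move/eqP: sE; rewrite mulf_eq0 (negbTE D0).
Qed.

(** A polynomial of size at most m + 1 with m + 1 distinct roots is zero. *)
Lemma poly_zero_of_many_roots (R : realType) m (u : 'I_m.+1 -> R) (w d : R) : 0
  < d ->
  (forall t, 0 <= t < d -> \sum_k u k * (w + t) ^+ k = 0) -> forall k, u k = 0.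
Proof.
move=> d0 H; pose P := \poly_(k < m.+1) u (inord k).
suff P0 : P = 0.
  by move=> k; have := congr1 (fun Q : {poly R} => Q`_k) P0;
    rewrite coef_poly ltn_ord inord_val coef0.
apply/eqP; apply: contraT => Pn0.
(* Dividing by [j.+2] keeps every increment strictly below [d]. *)
pose rs := mkseq (fun j => w + d / j.+2%:R) m.+1.
have urs : uniq rs.
  apply: mkseq_uniq => j k /addrI /(mulfI (lt0r_neq0 d0)) /invr_inj /eqP.
  by rewrite eqr_nat => /eqP[].
have ars : all (root P) rs.
  apply/allP => q /mapP[j _ ->]; rewrite /root horner_poly; apply/eqP.
  rewrite -[RHS](H (d / j.+2%:R)); last first.
    by rewrite divr_ge0 ?ltW //= ltr_pdivrMr // ltr_pMr // ltr1n.
  by apply: eq_bigr => k _; rewrite inord_val.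
have := leq_trans (max_poly_roots Pn0 ars urs) (size_poly _ _).
by rewrite size_mkseq ltnn.
Qed.

(** Modulo [B], m + 1 elements have coefficient rows of length m, so these rows satisfy a nontrivial
    relation, found in the kernel of an (m+1) x m matrix. The remainders [y k] in [B] are exhibited,
    so that they can be evaluated one by one on the zero locus. *)
Lemma finite_dim_dependent (R : realType) (Z : lmodType R) (A B : set Z) :
  finite_dim_quotient A B -> exists m, forall z : 'I_m.+1 -> Z, (forall k,
    A (z k)) ->
  exists2 u : 'I_m.+1 -> R, (exists k, u k != 0) &
    exists y : 'I_m.+1 -> Z, (forall k, B (y k)) /\
      \sum_k u k *: z k = \sum_k u k *: y k.
Proof.
move=> [m [e [_ eA]]]; exists m => z Az.
have /choice[C CB] k : exists c : 'I_m -> R,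
  B (z k - \sum_(l < m) c l *: e l) by apply: eA.
pose CM : 'M[R]_(m.+1, m) := \matrix_(k, l) C k l.
have : kermx CM != 0.
  by rewrite kermx_eq0 /row_free; apply: contraTneq (rank_leq_col CM) => ->;
    rewrite ltnn.
move=> /rowV0Pn[v /sub_kermxP vC vn0].
exists (v 0).
  have [k vk] : exists k, v 0 k != 0.
    apply/existsP; apply: contraNT vn0 => /existsPn H; apply/eqP/rowP => k.
    by rewrite mxE; apply/eqP; have := H k; rewrite negbK.
  by exists k.
exists (fun k => z k - \sum_(l < m) C k l *: e l); split=> //.
under [RHS]eq_bigr do rewrite scalerBr.
rewrite sumrB [X in _ - X](_ : _ = 0) ?subr0 //.
under eq_bigr do rewrite scaler_sumr.
rewrite exchange_big /= big1 // => l _.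
under eq_bigr do rewrite scalerA.
rewrite -scaler_suml; have -> : \sum_k v 0 k * C k l = (v *m CM) 0 l.
  by rewrite [RHS]mxE; apply: eq_bigr => k _; rewrite mxE.
by rewrite vC mxE scale0r.
Qed.

Lemma distinct_ordinals n (a : 'I_n) : (2 < n)%N ->
  exists b c : 'I_n, [/\ a != b, a != c & b != c].
Proof.
move=> n2; have n0 : (0 < n)%N by apply: ltn_trans n2.
have n1 : (1 < n)%N by apply: ltn_trans n2.
pose o0 := Ordinal n0; pose o1 := Ordinal n1; pose o2 := Ordinal n2.
have [->|a0] := eqVneq a o0; first by exists o1, o2.
have [->|a1] := eqVneq a o1; first by exists o0, o2.
by exists o0, o1.
Qed.

(** * Coboundaries on the zero locus *)

Section LinearSpan.
Variables (R : realType) (n : nat) (M : smooth_manifold R n) (L : nvector_data M).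
Variables (i : atlas_index M) (x : 'rV[R]_n) (b : 'I_n).

Let ev (X : vfield_data M) : R := X i x 0 b.

Lemma ev_sum m (c : 'I_m -> R) (X : 'I_m -> vfield_data M) :
  ev (\sum_k c k *: X k) = \sum_k c k * ev (X k).
Proof.
rewrite (big_morph ev (id1 := 0) (op1 := +%R)); last by rewrite /ev mxE.
  by apply: eq_bigr => k _; rewrite /ev mxE.
by move=> Y Z; rewrite /ev mxE.
Qed.

(* The b-th component of a field at x is its value on a global function g that
   agrees with the b-th coordinate near x. *)
Lemma coboundary_component0 (g : M -> R) : smooth_fun g -> cod (atlas i) x -> L
  i x = 0 ->
  {near x, (fun y : 'rV[R]_n => y 0 b) =1 g \o param (atlas i)} ->
  forall X, nambu_coboundaries L X -> X i x 0 b = 0.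
Proof.
move=> sg cx Lx gb X [m [c [H [HH ->]]]].
rewrite -[LHS]/(ev _) ev_sum big1 // => k _.
have [f sf [vX HX]] := HH k.
have := HX g sg i x cx; rewrite /nambu_bracket Lx mul0r /vfield_apply.
have dc : differentiable (fun y : 'rV[R]_n =>
  y 0 b) x by exact: differentiable_coord.
have [_ ->] := near_eq_diff gb dc.
rewrite (diff_partial _ dc) (bigD1 b) //= partial_coord eqxx mulr1 big1 ?addr0.
  by rewrite /ev => ->; rewrite mulr0.
by move=> d db; rewrite partial_coord (negbTE db) mulr0.
Qed.

End LinearSpan.

(** * Independent classes from powers of a coordinate *)

Theorem mainTheorem4 (R : realType) (n : nat) (M : smooth_manifold R n)
    (L : nvector_data M)
    (dim_gt2 : (2 < n)%N)
    (M_compact : compact [set: M])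
    (M_oriented : oriented_manifold M)
    (L_nvector : nvector_field L)
    (L_generic : generic L)
    (L_zeros : zero_locus L !=set0) :
  nambu_H1_infinite_dimensional L.
Proof.
move=> /finite_dim_dependent[m dep].
have [p [i ip Lp]] := L_zeros.
set x0 := Defs.coord (atlas i) p in Lp.
have cx0 : cod (atlas i) x0 by exact: coord_cod.
have [sL _ _] := L_nvector.
pose h := L i; have sh : smooth_on (cod (atlas i)) h by exact: sL.
have oc := @open_cod _ _ _ (atlas i).
have [a ha] : exists a, partial a h x0 != 0.
  apply: contrapT => nex.
  (* Transversality tested on the vertical vector (0, 1) gives 1 = dh(v), impossible if all partial
     derivatives of [h] vanish at [x0]. *)
  have [u [v E]] := @L_generic i x0 cx0 Lp 0 1.
  have /= := f_equal snd E.
  rewrite add0r diff_partial; last exact: smooth_on_diff sh cx0.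
  rewrite big1 => [/eqP|d _]; first by rewrite oner_eq0.
  have [->|hd] := eqVneq (partial d h x0) 0; first by rewrite mulr0.
  by case: nex; exists d.
have [b [c [ab ac bc]]] := distinct_ordinals a dim_gt2.
have [psi [K [spsi cK Kc psi0 psi1]]] := bump_exists oc cx0.
have clK : closed K.
  by apply: compact_closed cK; exact: norm_hausdorff.
pose D := partial a h x0.
have D_near : \forall y \near x0, 0 < D * partial a h y.
  have pc : {for x0, continuous (partial a h)}.
    apply: differentiable_continuous;
      exact: smooth_on_diff (smooth_on_partial a sh) cx0.
  have Dc : (fun y => D * partial a h y) @ x0 --> D * partial a h x0.
    by apply: cvgM pc; exact: cvg_cst.
  by apply: (cvgr_gt _ Dc); rewrite -expr2 exprn_even_gt0.
have c_near : nbhs x0 (cod (atlas i)) by apply: open_nbhs_nbhs.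
have := @filterI _ (nbhs x0) (nbhs_filter _) _ _ psi1
  (@filterI _ (nbhs x0) (nbhs_filter _) _ _ D_near c_near).
(* From here on the work is in a ball inside the chart where [psi] is 1 and the a-th derivative of
   [h] keeps its sign. *)
move/nbhs_ballP => [r /= r0 Br].
have {}Br y : `|y - x0| < r -> [/\ psi y = 1,
  0 < D * partial a h y & cod (atlas i) y].
  by move=> yr; have [|? []] := Br y; [rewrite -ball_normE /= distrC|split].
have near_r y : `|y - x0| < r -> \forall z \near y, `|z - x0| < r.
  move=> yr; apply/nbhs_ballP; exists (r - `|y - x0|);
    first by rewrite /= subr_gt0.
  move=> z; rewrite -ball_normE /= ltrBrDr distrC => yz.
  exact: le_lt_trans (ler_distD y _ _) yz.
(* The exponent is [k.+1] so that the derivatives along c run through all powers, including the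
   constant. *)
pose f k (y : 'rV[R]_n) := psi y * (y 0 c) ^+ k.+1.
have sc k : smooth_on setT (fun y : 'rV[R]_n => (y 0 c) ^+ k).
  elim: k => [|k IH].
    by rewrite (_ : (fun y => _) = cst 1) //; exact: smooth_on_cst.
  rewrite (_ : (fun y => _) = (fun y : 'rV[R]_n => y 0 c) * (fun y =>
    y 0 c ^+ k)).
    by apply: smooth_onM => //; [exact: openT|exact: smooth_on_coord].
  by apply/funext => y; rewrite exprS.
have sf k : smooth_on (cod (atlas i)) (f k).
  apply: (@smooth_on_sub _ _ setT) => //.
  by apply: (@smooth_onM _ _ _ psi) => //; exact: openT.
have f0 k y : ~ K y -> f k y = 0 by move=> /psi0 E; rewrite /f E mul0r.
pose X k := cross h (f k) a b c.
have zX k : nambu_cocycles L (extend_vfield i (X k)).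
  apply: (cocycle_extend cK Kc) => //.
  - exact: smooth_cross.
  - exact: cross_off clK (f0 k).
  - by move=> y cy; exact: (lie_cross ab ac bc oc).
(* Extended by zero, [g] is the global test function that reads off the b-th component of a field
   near [x0]. *)
pose g (y : 'rV[R]_n) := psi y * y 0 b.
have sg : smooth_fun (extend_fun i g).
  apply: (smooth_extend_fun cK Kc).
    apply: (@smooth_on_sub _ _ setT) => //.
    by apply: (@smooth_onM _ _ _ psi) => //;
      [exact: openT|exact: smooth_on_coord].
  by move=> y /psi0 E; rewrite /g E mul0r.
have XE k y : `|y - x0| < r -> extend_vfield i (X k) i y 0 b =
    - partial a h y * (k.+1%:R * (y 0 c) ^+ k).
  move=> yr; have [_ _ cy] := Br y yr.
  rewrite (extend_vfieldE _ cy); have [_ -> _ _] := crossE h (f k) ab ac bc y.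
  rewrite -[LHS]/(partial c h y * partial a (f k) y - partial a h y * partial c
    (f k) y).
  have fE : {near y, (fun z : 'rV[R]_n => z 0 c) ^+ k.+1 =1 f k}.
    apply: filterS (near_r y yr) => z zr; have [p1 _ _] := Br z zr.
    by rewrite exprfctE /f p1 mul1r.
  have pf d : partial d (f k) y = k.+1%:R * (y 0 c) ^+ k * (d == c)%:R.
    rewrite -(near_eq_partial d fE) /partial deriveX; last first.
      by apply: diff_derivable; exact: differentiable_coord.
    by rewrite -/(partial _ _ _) partial_coord.
  by rewrite !pf eqxx (negbTE ac) !mulr0 mulr1 sub0r mulNr.
(* If the quotient were spanned by m classes, the m + 1 cocycles built from [f 0], ..., [f m] would
   be dependent modulo coboundaries. *)
have [u [k0 uk0] [y [By E]]] := dep (fun k => extend_vfield i (X k)) (fun k =>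
  zX k).
(* Moving along c and correcting along a stays in the zero locus, while the c-th coordinate sweeps
   an interval because a and c differ. *)
have [d d0 zeros] : exists2 d : R, 0 < d & forall t, 0 <= t < d ->
    exists2 s, `|x0 + s *: delta_mx 0 a + t *: delta_mx 0 c - x0| < r &
      h (x0 + s *: delta_mx 0 a + t *: delta_mx 0 c) = 0.
  apply: (@zeros_along _ _ h x0 (delta_mx 0 a) (delta_mx 0 c) r D r0) =>
    // z /Br[_ ? cz] //.
  exact: smooth_on_diff sh cz.
(* At such a zero the b-th component of the relation has right-hand side 0; dividing by the nonzero
   factor [- partial a h x] leaves a polynomial in the c-th coordinate. *)
have many t : 0 <= t < d -> \sum_k (u k * k.+1%:R) * (x0 0 c + t) ^+ k = 0.
  move=> /zeros[s]; set x := (x0 + _ + _) => xr hx; have [_ Dx cx] := Br x xr.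
  have xc : x 0 c = x0 0 c + t.
    by rewrite !mxE !eqxx (negbTE (_ : c != a)) 1?eq_sym //= mulr0 addr0 mulr1.
  have gb : {near x, (fun z : 'rV[R]_n =>
    z 0 b) =1 extend_fun i g \o param (atlas i)}.
    apply: filterS (near_r x xr) => z zr; have [p1 _ cz] := Br z zr.
    by rewrite /= extend_funE // /g p1 mul1r.
  have := f_equal (fun Y : vfield_data M => Y i x 0 b) E.
  rewrite !ev_sum [RHS]big1 => [|k _]; last first.
    by rewrite (coboundary_component0 sg cx hx gb (By k)) mulr0.
  have hx0 : - partial a h x != 0.
    by rewrite oppr_eq0; apply/eqP => h0; rewrite h0 mulr0 ltxx in Dx.
  move=> S0; apply: (mulfI hx0); rewrite mulr0; apply: etrans S0;
    rewrite big_distrr /=; apply: eq_bigr => k _.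
  by rewrite XE // xc; ring.
have := poly_zero_of_many_roots d0 many k0.
by move/eqP; rewrite mulf_eq0 (negbTE uk0) pnatr_eq0.
Qed.
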